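(* Let $\Lambda$ be a basic Artin algebra, let $e_1,\dots,e_n$ be a complete set of orthogonal primitive idempotents of $\Lambda$, and suppose that the subsum $e=e_1+\cdots+e_m$ includes all idempotents $e_i$ for which the simple left module $\Lambda e_i/Je_i$ has infinite projective dimension, where $J$ is the Jacobson radical of $\Lambda$. Suppose that $e\Lambda(1-e)$ has finite projective dimension as a left module over the corner algebra $e\Lambda e$. Then $\mathcal{P}^{<\infty}(\Lambda\text{-mod})$ is contravariantly finite in $\Lambda\text{-mod}$ if and only if $\mathcal{P}^{<\infty}(e\Lambda e\text{-mod})$ is contravariantly finite in $e\Lambda e\text{-mod}$.
   Context: For an Artin algebra $A$, $A\text{-mod}$ is the category of finitely generated left $A$-modules and $\mathcal{P}^{<\infty}(A\text{-mod})$ its full subcategory of modules of finite projective dimension. $A$ is basic if $A/J(A)$ is a product of division rings. $\mathcal{P}^{<\infty}(A\text{-mod})$ is contravariantly finite in $A\text{-mod}$ if for each $M\in A\text{-mod}$ there is a map $\phi:X\to M$ with $X\in\mathcal{P}^{<\infty}(A\text{-mod})$ through which every homomorphism from an object of $\mathcal{P}^{<\infty}(A\text{-mod})$ to $M$ factors. *)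

(* Defs.v *)
From HB Require Import structures.
From mathcomp Require Import all_boot all_order all_algebra.
From mathcomp Require Import boolp.

Set Implicit Arguments.
Unset Strict Implicit.
Unset Printing Implicit Defensive.

Import GRing.Theory.
Local Open Scope ring_scope.

(* Rings are [pzRingType], so that the zero ring is allowed: the corner ring of
   the idempotent 0 is the zero ring.  Left ideals of [R] are the submodules of
   the regular left module [R^o]. *)

Section Modules.
Variable R : pzRingType.

Definition finitely_generated (M : lmodType R) : Prop :=
  exists (d : nat) (g : 'I_d -> M),
    forall x : M, exists c : 'I_d -> R, x = \sum_(i < d) c i *: g i.

Definition surjective_map (A B : Type) (f : A -> B) : Prop :=
  forall y, exists x, f x = y.

Definition projective (P : lmodType R) : Prop :=
  forall (M N : lmodType R) (g : {linear M -> N}) (f : {linear P -> N}),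
    surjective_map g -> exists h : {linear P -> M}, forall x, g (h x) = f x.

Definition exact_at (A B C : lmodType R)
    (f : {linear A -> B}) (g : {linear B -> C}) : Prop :=
  forall y : B, g y = 0 <-> exists x : A, f x = y.

(* There is a projective resolution 0 -> P_l -> ... -> P_0 -> M -> 0; the modules
   P_i need not be finitely generated. *)
Definition pdim_le (l : nat) (M : lmodType R) : Prop :=
  exists (P : nat -> lmodType R)
         (d : forall i, {linear P i.+1 -> P i})
         (a : {linear P 0%N -> M}),
    [/\ forall i, projective (P i),
        surjective_map a,
        exact_at (d 0%N) a,
        forall i, exact_at (d i.+1) (d i)
      & forall i, (l < i)%N -> forall x : P i, x = 0].

Definition finite_pdim (M : lmodType R) : Prop := exists l, pdim_le l M.

Definition in_Pfin (M : lmodType R) : Prop :=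
  finitely_generated M /\ finite_pdim M.

Definition Pfin_contravariantly_finite : Prop :=
  forall M : lmodType R, finitely_generated M ->
  exists (X : lmodType R) (phi : {linear X -> M}),
    in_Pfin X /\
    forall (Y : lmodType R) (f : {linear Y -> M}), in_Pfin Y ->
    exists g : {linear Y -> X}, forall y, f y = phi (g y).

Section QuotientModule.
Variables (M : lmodType R) (N : {pred M}) (subN : submod_closed N).

Definition submod_zmodClosed : zmodClosed M :=
  HB.pack (N : M -> bool)
    (GRing.isZmodClosed.Build M N (GRing.submod_closedB subN)).
Local Notation Quot := (Quotient.quot submod_zmodClosed).

Definition quot_module : Type := Quot.
HB.instance Definition _ := GRing.Zmodule.on quot_module.

Definition quot_proj (x : M) : quot_module := (\pi_Quot x)%qT.

Let quot_scale (a : R) (u : quot_module) : quot_module :=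
  quot_proj (a *: repr (u : Quot)).

Lemma quot_projE x y : (quot_proj x = quot_proj y) <-> x - y \in N.
Proof.
by rewrite (Quotient.idealrBE submod_zmodClosed); split=> [?|/eqP//]; apply/eqP.
Qed.

Let quot_projD x y : quot_proj (x + y) = quot_proj x + quot_proj y.
Proof. exact: raddfD (\pi_Quot%qT : {additive M -> Quot}) x y. Qed.

Let quot_projS a x : quot_scale a (quot_proj x) = quot_proj (a *: x).
Proof.
apply/quot_projE; rewrite -scalerBr -[_ *: _]addr0.
apply: (proj2 subN); last exact: (proj1 subN).
by apply/quot_projE; rewrite /quot_proj reprK.
Qed.

Let quot_projK (u : quot_module) : exists x, u = quot_proj x.
Proof. by exists (repr (u : Quot)); rewrite /quot_proj reprK. Qed.

Fact quot_scalerA a b u : quot_scale a (quot_scale b u) = quot_scale (a * b) u.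
Proof. by have [x ->] := quot_projK u; rewrite !quot_projS scalerA. Qed.
Fact quot_scale1r : left_id 1 quot_scale.
Proof. by move=> u; have [x ->] := quot_projK u; rewrite quot_projS scale1r. Qed.
Fact quot_scalerDr : right_distributive quot_scale +%R.
Proof.
move=> a u v; have [x ->] := quot_projK u; have [y ->] := quot_projK v.
by rewrite -quot_projD !quot_projS scalerDr quot_projD.
Qed.
Fact quot_scalerDl u : {morph quot_scale^~ u : a b / a + b}.
Proof.
by move=> a b; have [x ->] := quot_projK u; rewrite !quot_projS scalerDl quot_projD.
Qed.
HB.instance Definition _ := GRing.Zmodule_isLmodule.Build R quot_module
  quot_scalerA quot_scale1r quot_scalerDr quot_scalerDl.

End QuotientModule.

End Modules.

Section Radical.
Variable R : pzRingType.

Definition maximal_left_ideal (I : {pred R^o}) : Prop :=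
  [/\ submod_closed I, 1 \notin I
    & forall K : {pred R^o}, submod_closed K -> {subset I <= K} ->
        1 \notin K -> {subset K <= I}].

Definition jacobson : {pred R^o} :=
  fun x => `[< forall I, maximal_left_ideal I -> x \in I >].

Lemma jacobsonP x :
  reflect (forall I, maximal_left_ideal I -> x \in I) (x \in jacobson).
Proof. exact: asboolP. Qed.

Fact jacobson_submod : submod_closed jacobson.
Proof.
split=> [|a x y /jacobsonP Jx /jacobsonP Jy].
  by apply/jacobsonP => I [[]].
apply/jacobsonP => I mI; have [[_ lI] _ _] := mI.
by apply: lI; [apply: Jx | apply: Jy].
Qed.
HB.instance Definition _ :=
  GRing.isSubmodClosed.Build R R^o jacobson jacobson_submod.

Lemma jacobson_mull (r x : R) : x \in jacobson -> r * x \in jacobson.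
Proof.
move=> Jx; rewrite -[r * x]addr0.
by apply: (proj2 jacobson_submod r); last exact: (proj1 jacobson_submod).
Qed.

(* For a maximal left ideal I and r \notin I, the left ideal {y | y * r \in I}
   is again maximal. *)
Lemma jacobson_mulr (x r : R) : x \in jacobson -> x * r \in jacobson.
Proof.
move=> /jacobsonP Jx; apply/jacobsonP => I mI.
have [[I0 lI] nI1 maxI] := mI.
have II (a y z : R) : y \in I -> z \in I -> a * y + z \in I by exact: lI.
have [rI|nrI] := boolP (r \in I).
  by rewrite -[x * r]addr0; apply: II.
pose I' : {pred R^o} := fun y : R => y * r \in I.
suff: x \in I' by [].
apply: Jx; split.
- split=> [|a y z yI zI]; rewrite unfold_in ?mul0r//.
  have -> : (a *: y + z) * r = a * (y * r) + z * r.
    by rewrite mulrDl mulrA.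
  exact: II.
- by rewrite unfold_in mul1r.
move=> K [K0 lK] sIK nK1 y Ky; rewrite unfold_in; apply: contraT => nyr.
have KK (a u v : R) : u \in K -> v \in K -> a * u + v \in K by exact: lK.
pose L (s : R) : {pred R^o} :=
  fun z => `[< exists b c, [/\ c \in I & (z : R) = b * s + c] >].
have LT (s z : R) : s \notin I -> z \in L s.
  move=> nsI; have Lmod : submod_closed (L s).
    split; first by apply/asboolP; exists 0, 0; rewrite mul0r addr0.
    move=> a u v /asboolP[b [c [cI ->]]] /asboolP[b' [c' [cI' ->]]].
    apply/asboolP; exists (a * b + b'), (a * c + c'); split; first exact: II.
    by rewrite /GRing.scale/= mulrDl mulrDr !mulrA addrACA.
  have L1 : 1 \in L s.
    apply: contraT => nL1; case/negP: nsI; apply: maxI nL1 _ _ => //.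
      by move=> c cI; apply/asboolP; exists 0, c; rewrite mul0r add0r.
    by apply/asboolP; exists 1, 0; rewrite mul1r addr0.
  by case: Lmod => L0 /(_ z 1 0 L1 L0); rewrite addr0 /GRing.scale/= mulr1.
have /asboolP[b [c [cI rE]]] := LT (y * r) r nyr.
case/negP: nK1; have -> : 1 = b * y + (1 - b * y) :> R by rewrite addrC subrK.
apply: KK => //; apply: sIK; rewrite unfold_in.
by rewrite mulrBl mul1r -mulrA {1}rE addrAC subrr add0r.
Qed.

Local Notation Quot := (Quotient.quot (submod_zmodClosed jacobson_submod)).

Definition quot_rad : Type := quot_module jacobson_submod.
HB.instance Definition _ := GRing.Zmodule.on quot_rad.

Definition rad_proj (x : R) : quot_rad := quot_proj jacobson_submod x.

Let rad_mul (u v : quot_rad) : quot_rad :=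
  rad_proj (repr (u : Quot) * repr (v : Quot) : R).

Let rad_projE x y : (rad_proj x = rad_proj y) <-> x - y \in jacobson.
Proof. exact: quot_projE. Qed.

Let rad_projD x y : rad_proj (x + y) = rad_proj x + rad_proj y.
Proof.
exact: raddfD (\pi_Quot%qT : {additive R^o -> Quot}) x y.
Qed.

Let rad_projM x y : rad_mul (rad_proj x) (rad_proj y) = rad_proj (x * y).
Proof.
have reprJ z : (repr (rad_proj z : Quot) : R) - z \in jacobson.
  by apply/rad_projE; rewrite /rad_proj /quot_proj reprK.
apply/rad_projE; set x' : R := repr _; set y' : R := repr _.
have -> : x' * y' - x * y = x' * (y' - y) + (x' - x) * y.
  by rewrite mulrBr mulrBl addrA subrK.
apply: (@rpredD R^o jacobson); first exact/jacobson_mull/reprJ.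
exact/jacobson_mulr/reprJ.
Qed.

Let rad_projK (u : quot_rad) : exists x, u = rad_proj x.
Proof.
by exists (repr (u : Quot)); rewrite /rad_proj /quot_proj reprK.
Qed.

Fact rad_mulA : associative rad_mul.
Proof.
move=> u v w; have [x ->] := rad_projK u; have [y ->] := rad_projK v.
by have [z ->] := rad_projK w; rewrite !rad_projM mulrA.
Qed.
Fact rad_mul1r : left_id (rad_proj 1) rad_mul.
Proof. by move=> u; have [x ->] := rad_projK u; rewrite rad_projM mul1r. Qed.
Fact rad_mulr1 : right_id (rad_proj 1) rad_mul.
Proof. by move=> u; have [x ->] := rad_projK u; rewrite rad_projM mulr1. Qed.
Fact rad_mulDl : left_distributive rad_mul +%R.
Proof.
move=> u v w; have [x ->] := rad_projK u; have [y ->] := rad_projK v.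
by have [z ->] := rad_projK w; rewrite -rad_projD !rad_projM mulrDl rad_projD.
Qed.
Fact rad_mulDr : right_distributive rad_mul +%R.
Proof.
move=> u v w; have [x ->] := rad_projK u; have [y ->] := rad_projK v.
by have [z ->] := rad_projK w; rewrite -rad_projD !rad_projM mulrDr rad_projD.
Qed.
HB.instance Definition _ := GRing.Zmodule_isPzRing.Build quot_rad
  rad_mulA rad_mul1r rad_mulr1 rad_mulDl rad_mulDr.

End Radical.

Arguments jacobson R : clear implicits.

Definition division_ring (D : nzRingType) : Prop :=
  forall x : D, x != 0 -> exists y, x * y = 1 /\ y * x = 1.

(* The second condition says that the ring morphism into the product of the
   D i with components p i is bijective. *)
Definition basic (R : pzRingType) : Prop :=
  exists (s : nat) (D : 'I_s -> nzRingType)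
         (p : forall i, {rmorphism quot_rad R -> D i}),
    (forall i, division_ring (D i)) /\
    (forall y : (forall i, D i), exists! x, forall i, p i x = y i).

Definition left_artinian (R : pzRingType) : Prop :=
  forall I : nat -> {pred R^o},
    (forall i, submod_closed (I i)) ->
    (forall i, {subset I i.+1 <= I i}) ->
    exists l, forall i, (l <= i)%N -> I i =i I l.

(* An algebra over a commutative ring k is given by its structure morphism
   from k into the center; the library's [algType] would exclude the zero
   algebra. *)
Definition artin_algebra (A : pzRingType) : Prop :=
  exists (k : comPzRingType) (f : {rmorphism k -> A}),
    [/\ left_artinian k,
        forall (a : k) (x : A), f a * x = x * f a
      & exists (d : nat) (g : 'I_d -> A),
          forall x : A, exists c : 'I_d -> k, x = \sum_(i < d) f (c i) * g i].

Section Idempotents.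
Variable R : pzRingType.

Record idempotent_elt := Idempotent {
  idem_val :> R;
  idemP : idem_val * idem_val = idem_val }.

Definition primitive_idempotent (e : R) : Prop :=
  [/\ e * e = e, e != 0
    & forall f g : R, f * f = f -> g * g = g -> f * g = 0 -> g * f = 0 ->
        e = f + g -> f = 0 \/ g = 0].

Definition complete_orth_primitive (n : nat) (eps : 'I_n -> R) : Prop :=
  [/\ forall i, primitive_idempotent (eps i),
      forall i j, i != j -> eps i * eps j = 0
    & \sum_(i < n) eps i = 1].

(* R e / J e, where J is the Jacobson radical; it is simple when e is a primitive
   idempotent of a left artinian ring R. *)
Section SimpleTop.
Variable e : R.

Definition lprincipal_pred : {pred R^o} :=
  fun x => `[< exists r : R, x = r * e >].

Fact lprincipal_submod : submod_closed lprincipal_pred.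
Proof.
split=> [|a x y /asboolP[r ->] /asboolP[s ->]]; apply/asboolP.
  by exists 0; rewrite mul0r.
by exists (a * r + s); rewrite mulrDl -mulrA.
Qed.
HB.instance Definition _ :=
  GRing.isSubmodClosed.Build R R^o lprincipal_pred lprincipal_submod.

Record lprincipal := Lprincipal {
  lprincipal_val :> R^o; _ : lprincipal_val \in lprincipal_pred }.
HB.instance Definition _ := [isSub for lprincipal_val].
HB.instance Definition _ := [Choice of lprincipal by <:].
HB.instance Definition _ := [SubChoice_isSubLmodule of lprincipal by <:].

Definition rad_lprincipal : {pred lprincipal} :=
  fun u => `[< exists2 j : R, j \in jacobson R & val u = j * e >].

Fact rad_lprincipal_submod : submod_closed rad_lprincipal.
Proof.
split=> [|a u v /asboolP[j Jj uE] /asboolP[j' Jj' vE]]; apply/asboolP.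
  by exists 0; rewrite ?rpred0 ?mul0r.
exists (a * j + j').
  by apply: (@rpredD R^o (jacobson R)) => //; apply: jacobson_mull.
have -> : val (a *: u + v) = a * (val u : R) + (val v : R) by [].
by rewrite uE vE mulrDl -mulrA.
Qed.
HB.instance Definition _ :=
  GRing.isSubmodClosed.Build R lprincipal rad_lprincipal rad_lprincipal_submod.

Definition simple_top : lmodType R := quot_module rad_lprincipal_submod.

End SimpleTop.

Section Peirce.
Variables (e : idempotent_elt) (f : R).

Definition peirce_pred : {pred R} :=
  fun x => `[< exists r : R, x = idem_val e * r * f >].

Fact peirce_zmod : zmod_closed peirce_pred.
Proof.
split=> [|x y /asboolP[r ->] /asboolP[s ->]]; apply/asboolP.
  by exists 0; rewrite mulr0 mul0r.
by exists (r - s); rewrite mulrBr mulrBl.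
Qed.
HB.instance Definition _ := GRing.isZmodClosed.Build R peirce_pred peirce_zmod.

(* e R f, with the action of the corner ring e R e by multiplication in R.  The
   corner ring has identity e, hence the restriction to idempotents e. *)
Record peirce := Peirce { peirce_val :> R; _ : peirce_val \in peirce_pred }.
HB.instance Definition _ := [isSub for peirce_val].
HB.instance Definition _ := [Choice of peirce by <:].
HB.instance Definition _ := [SubChoice_isSubZmodule of peirce by <:].

Lemma peirce_idl (x : peirce) : idem_val e * val x = val x.
Proof. by have /asboolP[r ->] := valP x; rewrite !mulrA idemP. Qed.

Fact peirce_act_subproof (a x : R) :
  (exists r : R, a = idem_val e * r * idem_val e) ->
  x \in peirce_pred -> a * x \in peirce_pred.
Proof.
move=> [r ->] /asboolP[s ->]; apply/asboolP.
by exists (r * idem_val e * idem_val e * s); rewrite !mulrA.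
Qed.

End Peirce.

Section Corner.
Variable e : idempotent_elt.

Definition corner : Type := peirce e e.
HB.instance Definition _ := GRing.Zmodule.on corner.

Fact corner_one_subproof : idem_val e \in peirce_pred e e.
Proof. by apply/asboolP; exists 1; rewrite mulr1 idemP. Qed.

Definition corner_one : corner := Peirce corner_one_subproof.

Definition peirce_act (f : R) (a : corner) (x : peirce e f) : peirce e f :=
  Peirce (peirce_act_subproof (asboolW (valP (a : peirce e e))) (valP x)).

Definition corner_mul (a b : corner) : corner := peirce_act a b.

Lemma peirce_idr (x : peirce e e) : val x * idem_val e = val x.
Proof. by have /asboolP[r ->] := valP x; rewrite -mulrA idemP. Qed.

Fact corner_mulA : associative corner_mul.
Proof. by move=> x y z; apply: val_inj; rewrite /= mulrA. Qed.
Fact corner_mul1r : left_id corner_one corner_mul.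
Proof. by move=> x; apply: val_inj; apply: peirce_idl. Qed.
Fact corner_mulr1 : right_id corner_one corner_mul.
Proof. by move=> x; apply: val_inj; apply: peirce_idr. Qed.
Fact corner_mulDl : left_distributive corner_mul +%R.
Proof. by move=> x y z; apply: val_inj; apply: mulrDl. Qed.
Fact corner_mulDr : right_distributive corner_mul +%R.
Proof. by move=> x y z; apply: val_inj; apply: mulrDr. Qed.
HB.instance Definition _ := GRing.Zmodule_isPzRing.Build corner
  corner_mulA corner_mul1r corner_mulr1 corner_mulDl corner_mulDr.

Variable f : R.

Fact peirce_scalerA (a b : corner) (x : peirce e f) :
  peirce_act a (peirce_act b x) = peirce_act (a * b) x.
Proof. by apply: val_inj; rewrite /= mulrA. Qed.
Fact peirce_scale1r : left_id (1 : corner) (@peirce_act f).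
Proof. by move=> x; apply: val_inj; apply: peirce_idl. Qed.
Fact peirce_scalerDr : right_distributive (@peirce_act f) +%R.
Proof. by move=> a x y; apply: val_inj; apply: mulrDr. Qed.
Fact peirce_scalerDl (x : peirce e f) :
  {morph (@peirce_act f)^~ x : a b / a + b}.
Proof. by move=> a b; apply: val_inj; apply: mulrDl. Qed.

HB.instance Definition _ := GRing.Zmodule_isLmodule.Build corner (peirce e f)
  peirce_scalerA peirce_scale1r peirce_scalerDr peirce_scalerDl.

End Corner.

End Idempotents.

(* Main.v *)
(** Write C = eLe. The exact functor M |-> eM from L-mod to C-mod has the right
    adjoint X |-> Hom_C(eL, X), and e Hom_C(eL, X) = X. A finitely generated
    M has finite projective dimension if and only if eM does. Indeed eL has
    finite projective dimension over C, because e L (1-e) has. Conversely, every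
    finitely generated L-module killed by e has finite projective dimension,
    because its composition factors do, and a C-map from a projective module Q to
    eM lifts to a map from a projective P with eP = Q to M, whose kernel K and
    cokernel satisfy eK = ker (Q -> eM) and e(coker) = 0 if Q -> eM is onto; so
    one can induct on the projective dimension of eM.

    An approximation X of eM then yields the approximation of M given by the
    pullback of Hom_C(eL, X) -> Hom_C(eL, eM) along M -> Hom_C(eL, eM), and an
    approximation of Hom_C(eL, M') restricts to one of M'. *)

From HB Require Import structures.
Require Import Defs.
From mathcomp Require Import all_boot all_order all_algebra.
From mathcomp Require Import boolp classical_sets.

Set Implicit Arguments.
Unset Strict Implicit.
Unset Printing Implicit Defensive.

Import GRing.Theory.
Local Open Scope ring_scope.

(** * Submodules and linear maps *)

(** [pdim_le] allows projectives that are not finitely generated, while [eP] is controlled here only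
    for finitely generated [P]. The inductions on projective dimension therefore take a fresh
    finitely generated cover at each step, and a form of Schanuel's lemma with direct summands
    carries the bound over to its kernel. Finite generation of such kernels, and of Hom_C(eL, X), is
    decided over the ground ring [k]: over a commutative artinian ring, submodules of finitely
    generated modules are finitely generated. Composition series are replaced by a minimal
    counterexample. A minimal submodule N of infinite projective dimension has a maximal submodule
    V, and the hypothesis on the modules Lq/Jq enters through an exact sequence joining Jq, V, Lq
    and N, so that N/V is never identified with a simple top. Taking M = 0 in the pullback gives
    Hom_C(eL, X) itself, so that one construction serves both implications. *)

Section LinearMap.
Variables (R : pzRingType) (U V : lmodType R) (f : U -> V) (lf : linear f).
Definition linear_map : {linear U -> V} :=
  HB.pack f (GRing.isLinear.Build R U V *:%R f lf).
End LinearMap.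

(** The closure proof is a parameter of the type, so that the module instance below can find it. *)
Record submodule (R : pzRingType) (M : lmodType R) (N : {pred M})
    (subN : submod_closed N) :=
  Submodule { submodule_val : M; _ : submodule_val \in N }.

Section Submodule.
Variables (R : pzRingType) (M : lmodType R) (N : {pred M}).
Variable subN : submod_closed N.
Local Notation submodule := (submodule subN).

HB.instance Definition _ := [isSub for @submodule_val R M N subN].
HB.instance Definition _ := [Choice of submodule by <:].
HB.instance Definition _ := GRing.SubChoice_isSubLmodule.Build R M N submodule
  (GRing.submod_closed_semi subN).

Lemma submodule_incl_linear : linear (@submodule_val R M N subN).
Proof. by []. Qed.
Definition submodule_incl : {linear submodule -> M} :=
  linear_map submodule_incl_linear.

Lemma submodule_inclP (x : submodule) : submodule_incl x \in N.
Proof. exact: valP. Qed.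

Lemma submodule_incl_inj : injective submodule_incl. Proof. exact: val_inj. Qed.

Lemma submodule_lift (x : M) : x \in N -> exists y, submodule_incl y = x.
Proof. by move=> xN; exists (Submodule subN xN). Qed.

End Submodule.

Section Corestriction.
Variables (R : pzRingType) (A M : lmodType R) (N : {pred M}).
Variables (subN : submod_closed N) (f : {linear A -> M}) (fN : forall x, f x \in N).

Lemma corestr_linear : linear (fun x => Submodule subN (fN x)).
Proof. by move=> a x y; apply: val_inj; rewrite /= linearP. Qed.
Definition corestr : {linear A -> submodule subN} := linear_map corestr_linear.
Lemma corestrE x : submodule_incl subN (corestr x) = f x. Proof. by []. Qed.
End Corestriction.

Section LinearConstructions.
Variable R : pzRingType.
Implicit Types A B M N K P : lmodType R.

(** Any choice of preimages is linear, by injectivity of [i]. *)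
Lemma inj_factor A B M (i : {linear A -> M}) (f : {linear B -> M}) :
    injective i -> (forall x, exists y, i y = f x) ->
  exists h : {linear B -> A}, forall x, i (h x) = f x.
Proof.
move=> iI /choice[h hE].
have lh : linear h by move=> a x y; apply: iI; rewrite linearP !hE linearP.
by exists (linear_map lh).
Qed.

Definition idmap M : {linear M -> M} := GRing.Linear.clone R M M *:%R (@idfun M) _.
Definition comp_map A B M (g : {linear B -> M}) (f : {linear A -> B}) :
  {linear A -> M} := GRing.Linear.clone R A M *:%R (g \o f) _.

Lemma add_linear A B (f g : {linear A -> B}) : linear (fun x => f x + g x).
Proof. by move=> a x y; rewrite !linearP scalerDr addrACA. Qed.
Definition add_map A B (f g : {linear A -> B}) : {linear A -> B} :=
  linear_map (add_linear f g).

Lemma opp_linear A B (f : {linear A -> B}) : linear (fun x => - f x).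
Proof. by move=> a x y; rewrite linearP opprD scalerN. Qed.
Definition opp_map A B (f : {linear A -> B}) : {linear A -> B} :=
  linear_map (opp_linear f).

Lemma zero_linear A B : linear (fun _ : A => 0 : B).
Proof. by move=> a x y; rewrite scaler0 addr0. Qed.
Definition zero_map A B : {linear A -> B} := linear_map (@zero_linear A B).

Lemma fst_linear A B : linear (fun x : A * B => x.1). Proof. by []. Qed.
Lemma snd_linear A B : linear (fun x : A * B => x.2). Proof. by []. Qed.
Definition fst_map A B : {linear (A * B)%type -> A} :=
  linear_map (@fst_linear A B).
Definition snd_map A B : {linear (A * B)%type -> B} :=
  linear_map (@snd_linear A B).

Lemma pair_linear A B M (f : {linear M -> A}) (g : {linear M -> B}) :
  linear (fun x => (f x, g x)).
Proof. by move=> a x y; rewrite !linearP. Qed.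
Definition pair_map A B M (f : {linear M -> A}) (g : {linear M -> B}) :
  {linear M -> (A * B)%type} := linear_map (pair_linear f g).

Definition copair_map A B M (f : {linear A -> M}) (g : {linear B -> M}) :
    {linear (A * B)%type -> M} :=
  add_map (comp_map f (fst_map A B)) (comp_map g (snd_map A B)).

Lemma scale_linear M (x : M) : linear (fun a : R^o => (a : R) *: x).
Proof. by move=> a b c; rewrite scalerDl scalerA. Qed.
Definition scale_map M (x : M) : {linear R^o -> M} :=
  linear_map (scale_linear x).

Definition lin_kernel A B (g : {linear A -> B}) : {pred A} := fun x => g x == 0.
Lemma lin_kernelP A B (g : {linear A -> B}) x :
  reflect (g x = 0) (x \in lin_kernel g).
Proof. exact: eqP. Qed.
Lemma lin_kernel_submod A B (g : {linear A -> B}) : submod_closed (lin_kernel g).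
Proof.
split=> [|a x y /lin_kernelP gx /lin_kernelP gy]; apply/lin_kernelP.
  exact: linear0.
by rewrite linearP gx gy scaler0 addr0.
Qed.

Definition lin_image A B (g : {linear A -> B}) : {pred B} :=
  fun y => `[< exists x, g x = y >].
Lemma lin_imageP A B (g : {linear A -> B}) y :
  reflect (exists x, g x = y) (y \in lin_image g).
Proof. exact: asboolP. Qed.
Lemma lin_image_submod A B (g : {linear A -> B}) : submod_closed (lin_image g).
Proof.
split=> [|a x y /lin_imageP[u <-] /lin_imageP[v <-]]; apply/lin_imageP.
  by exists 0; rewrite linear0.
by exists (a *: u + v); rewrite linearP.
Qed.

Definition zero_module : lmodType R := 'rV[R]_0.
Lemma zero_moduleP (x : zero_module) : x = 0. Proof. exact: thinmx0. Qed.

Definition short_exact K P M (i : {linear K -> P}) (a : {linear P -> M}) :=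
  [/\ injective i, surjective_map a & exact_at i a].

Lemma short_exact_kernel P M (a : {linear P -> M}) :
  surjective_map a -> short_exact (submodule_incl (lin_kernel_submod a)) a.
Proof.
move=> sa; split=> //; first exact: submodule_incl_inj.
move=> y; split=> [/lin_kernelP ay|[x <-]]; first exact: submodule_lift.
exact/lin_kernelP/submodule_inclP.
Qed.

Lemma short_exact_comp0 K P M (i : {linear K -> P}) (a : {linear P -> M}) x :
  short_exact i a -> a (i x) = 0.
Proof. by case=> _ _ /(_ (i x))[_]; apply; exists x. Qed.

Lemma short_exact_factor K P M N (i : {linear K -> P}) (a : {linear P -> M})
    (f : {linear N -> P}) : short_exact i a -> (forall x, a (f x) = 0) ->
  exists h : {linear N -> K}, forall x, i (h x) = f x.
Proof.
by case=> iI _ ex af; apply: inj_factor => // x; apply/(ex (f x)).1/af.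
Qed.

(** Direct summands are recorded by inclusion and projection, without a complement: additive
    functors preserve this form, and Schanuel's lemma below yields it. *)
Definition retract A B :=
  exists (s : {linear A -> B}) (p : {linear B -> A}), cancel s p.

Lemma retract_refl A : retract A A.
Proof. by exists (idmap A), (idmap A). Qed.

Lemma bij_retract A B (f : {linear A -> B}) :
  injective f -> surjective_map f -> retract A B /\ retract B A.
Proof.
move=> fI fS; have [|g gE] := inj_factor (f := idmap B) fI; first exact: fS.
have fK : cancel f g by move=> x; apply: fI; rewrite gE.
by split; [exists f, g | exists g, f].
Qed.

Lemma projective_retract A B : projective B -> retract A B -> projective A.
Proof.
move=> pB [s [p sp]] M N g f gS.
have [h hE] := pB M N g (comp_map f p) gS.
by exists (comp_map h s) => x /=; rewrite hE /= sp.
Qed.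

Lemma projective_pair A B :
  projective A -> projective B -> projective (A * B)%type.
Proof.
move=> pA pB M N g f gS.
have [h hE] := pA M N g (comp_map f (pair_map (idmap A) (zero_map A B))) gS.
have [k kE] := pB M N g (comp_map f (pair_map (zero_map B A) (idmap B))) gS.
exists (copair_map h k) => -[x y] /=; rewrite linearD hE kE /= -linearD.
by congr (f _); congr pair; rewrite /= ?addr0 ?add0r.
Qed.

Lemma projective_zero M : (forall x : M, x = 0) -> projective M.
Proof.
move=> M0 A B g f gS; exists (zero_map M A) => x.
by rewrite (M0 x) !linear0.
Qed.

Lemma projective_section M P (a : {linear M -> P}) :
  projective P -> surjective_map a -> exists s : {linear P -> M}, cancel s a.
Proof. by move=> pP aS; have [h] := pP _ _ a (idmap P) aS; exists h. Qed.

Definition free_module (d : nat) : lmodType R := {ffun 'I_d -> R^o}.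

Lemma comb_linear M d (g : 'I_d -> M) :
  linear (fun c : free_module d => \sum_(i < d) (c i : R) *: g i).
Proof.
move=> a c c'; rewrite scaler_sumr -big_split /=; apply: eq_bigr => i _.
by rewrite !ffunE scalerA -scalerDl.
Qed.
Definition comb M d (g : 'I_d -> M) : {linear free_module d -> M} :=
  linear_map (comb_linear g).

Lemma combE M d (g : 'I_d -> M) c : comb g c = \sum_(i < d) (c i : R) *: g i.
Proof. by []. Qed.

Definition free_gen d (i : 'I_d) : free_module d :=
  [ffun j => if i == j then 1 else 0].

Lemma comb_free_gen M d (g : 'I_d -> M) i : comb g (free_gen i) = g i.
Proof.
rewrite combE (bigD1 i) //= ffunE eqxx scale1r big1 ?addr0 // => j.
by rewrite eq_sym ffunE => /negbTE ->; rewrite scale0r.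
Qed.

Lemma free_moduleE d (c : free_module d) :
  c = \sum_(i < d) (c i : R) *: free_gen i.
Proof.
apply/ffunP => j; rewrite sum_ffunE (bigD1 j) //= !ffunE eqxx big1.
  by rewrite /GRing.scale /= mulr1 addr0.
by move=> i /negbTE ij; rewrite !ffunE ij scaler0.
Qed.

Lemma linear_free_eq M d (f g : {linear free_module d -> M}) :
  (forall i, f (free_gen i) = g (free_gen i)) -> forall c, f c = g c.
Proof.
move=> fg c; rewrite (free_moduleE c) !linear_sum; apply: eq_bigr => i _.
by rewrite !linearZ /= fg.
Qed.

Lemma projective_free d : projective (free_module d).
Proof.
move=> M N g f gS.
have [x xE] := choice (fun i : 'I_d => gS (f (free_gen i))).
exists (comb x) => c.
apply: (@linear_free_eq N d (comp_map g (comb x))) => i.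
by rewrite -[LHS]/(g (comb x (free_gen i))) comb_free_gen.
Qed.

Lemma projective_regular : projective (R^o : lmodType R).
Proof.
apply: (projective_retract (@projective_free 1)).
exists (scale_map (free_gen ord0)), (comb (fun=> 1 : R^o)) => x.
by rewrite combE big_ord1 !ffunE eqxx /GRing.scale /= !mulr1.
Qed.

Lemma finitely_generatedP M :
  finitely_generated M <->
  exists d (g : {linear free_module d -> M}), surjective_map g.
Proof.
split=> [[d [g gE]]|[d [g gS]]].
  exists d, (comb g) => x; have [c ->] := gE x; exists [ffun i => c i].
  by rewrite combE; apply: eq_bigr => i _; rewrite ffunE.
exists d, (fun i => g (free_gen i)) => x; have [c <-] := gS x; exists c.
by rewrite {1}(free_moduleE c) linear_sum; apply: eq_bigr => i _; rewrite linearZ.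
Qed.

Lemma fg_surj M N (f : {linear M -> N}) :
  surjective_map f -> finitely_generated M -> finitely_generated N.
Proof.
move=> fS /finitely_generatedP[d [g gS]]; apply/finitely_generatedP.
exists d, (comp_map f g) => y; have [x <-] := fS y; have [c <-] := gS x.
by exists c.
Qed.

Lemma fg_zero M : (forall x : M, x = 0) -> finitely_generated M.
Proof.
move=> M0; exists 0%N, (fun=> 0) => x; exists (fun=> 0).
by rewrite (M0 x) big_ord0.
Qed.

Lemma fg_free d : finitely_generated (free_module d).
Proof. by apply/finitely_generatedP; exists d, (idmap _) => x; exists x. Qed.

Lemma fg_pair M N : finitely_generated M -> finitely_generated N ->
  finitely_generated (M * N)%type.
Proof.
move=> [d [g gE]] [d' [g' gE']].
exists (d + d')%N, (fun i => match split i with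
  | inl j => (g j, 0) | inr j => (0, g' j) end) => -[x y].
have [c ->] := gE x; have [c' ->] := gE' y.
exists (fun i => match split i with inl j => c j | inr j => c' j end).
rewrite big_split_ord /=.
have -> : (\sum_(i < d) c i *: g i, \sum_(i < d') c' i *: g' i) =
   pair_map (idmap M) (zero_map M N) (\sum_(i < d) c i *: g i) +
   pair_map (zero_map N M) (idmap N) (\sum_(i < d') c' i *: g' i).
  by congr pair; rewrite /= ?addr0 ?add0r.
rewrite !linear_sum; congr (_ + _); apply: eq_bigr => i _.
  by rewrite linearZ (unsplitK (inl i)).
by rewrite linearZ (unsplitK (inr i)).
Qed.

(** [P] is the d-fold power of [N], built as iterated pairs. The maps [h i] will be the evaluations
    of Hom_C(eL, X) at generators of L over [k]. *)
Lemma joint_embedding M N d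
    (h : 'I_d -> {linear M -> N}) : finitely_generated N ->
  exists (P : lmodType R) (F : {linear M -> P}),
    finitely_generated P /\ forall x, F x = 0 -> forall i, h i x = 0.
Proof.
move=> fgN; elim: d h => [|d IHd] h.
  exists (zero_module), (zero_map M _); split=> [|x _ []] //.
  exact/fg_zero/zero_moduleP.
have [P [F [fgP FP]]] := IHd (fun i => h (lift ord0 i)).
exists (N * P)%type, (pair_map (h ord0) F); split; first exact: fg_pair.
move=> x Fx i; have [j ->|->] := unliftP ord0 i.
  exact: (FP x (congr1 snd Fx)).
exact: (congr1 fst Fx).
Qed.

End LinearConstructions.

(** * Projective dimension *)

Section ProjectiveDimension.
Variable R : pzRingType.
Implicit Types A B C K M N P : lmodType R.

(** A recursive form of [pdim_le], suited to induction on the dimension; [syzygy_pdim_le] shows that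
    the two agree. *)
Fixpoint syzygy_pdim (l : nat) M : Prop :=
  if l is l'.+1 then
    exists K P (i : {linear K -> P}) (a : {linear P -> M}),
      [/\ projective P, short_exact i a & syzygy_pdim l' K]
  else projective M.

Lemma syzygy_pdimS l M : syzygy_pdim l M -> syzygy_pdim l.+1 M.
Proof.
elim: l M => [|l IHl] M.
  move=> pM; exists (zero_module R), M, (zero_map _ M), (idmap M).
  split=> //; last exact/projective_zero/zero_moduleP.
  split=> [x y _|y|y]; first by rewrite (zero_moduleP x) (zero_moduleP y).
    by exists y.
  by split=> [/= ->|[x <-]]; [exists 0|].
move=> [K [P [i [a [pP ia KP]]]]].
by exists K, P, i, a; split=> //; apply: IHl.
Qed.

Lemma syzygy_pdim_leq l k M : (l <= k)%N -> syzygy_pdim l M -> syzygy_pdim k M.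
Proof.
move=> /subnK <-; elim: (k - l)%N => [|j IHj] // /IHj.
exact: syzygy_pdimS.
Qed.

Lemma short_exact_pair K P M K' P' M' (i : {linear K -> P}) (a : {linear P -> M})
    (i' : {linear K' -> P'}) (a' : {linear P' -> M'}) :
    short_exact i a -> short_exact i' a' ->
  exists (j : {linear (K * K')%type -> (P * P')%type})
         (b : {linear (P * P')%type -> (M * M')%type}), short_exact j b.
Proof.
move=> [iI aS ex] [iI' aS' ex'].
exists (pair_map (comp_map i (fst_map K K')) (comp_map i' (snd_map K K'))).
exists (pair_map (comp_map a (fst_map P P')) (comp_map a' (snd_map P P'))).
split=> [[x x'] [y y'] /= [] /iI -> /iI' -> //|[y y']|[y y']] /=.
  by have [x <-] := aS y; have [x' <-] := aS' y'; exists (x, x').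
split=> [[/ex[x <-] /ex'[x' <-]]|[[x x'] /= [<- <-]]]; first by exists (x, x').
by congr pair; [apply/ex; exists x | apply/ex'; exists x'].
Qed.

Lemma syzygy_pdim_pair l A B :
  syzygy_pdim l A -> syzygy_pdim l B -> syzygy_pdim l (A * B)%type.
Proof.
elim: l A B => [|l IHl] A B; first exact: projective_pair.
move=> [K [P [i [a [pP ia KP]]]]] [K' [P' [i' [a' [pP' ia' KP']]]]].
have [j [b jb]] := short_exact_pair ia ia'.
exists (K * K')%type, (P * P')%type, j, b; split=> //; last exact: IHl.
exact: projective_pair.
Qed.

(* A one-sided form of Schanuel's lemma. *)
Lemma schanuel_retract A B K P K' P' (i : {linear K -> P}) (a : {linear P -> A})
    (i' : {linear K' -> P'}) (a' : {linear P' -> B}) :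
    projective P -> projective P' -> short_exact i a -> short_exact i' a' ->
  retract A B -> retract K (K' * P)%type.
Proof.
move=> pP pP' ia ia' [s [p sp]].
have [iI aS ex] := ia; have [iI' aS' ex'] := ia'.
have [u uE] := pP _ _ a' (comp_map s a) aS'.
have [v vE] := pP' _ _ a (comp_map p a') aS.
have [uK uKE] : exists h : {linear K -> K'}, forall x, i' (h x) = u (i x).
  apply: (short_exact_factor (f := comp_map u i) ia') => x /=.
  by rewrite uE /= (short_exact_comp0 _ ia) linear0.
have [vK vKE] : exists h : {linear K' -> K}, forall x, i (h x) = v (i' x).
  apply: (short_exact_factor (f := comp_map v i') ia) => x /=.
  by rewrite vE /= (short_exact_comp0 _ ia') linear0.
(* [u] and [v] lift [s] and [p], and [p (s z) = z], so [a] kills [x - v (u x)]. On K, this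
   difference and [vK (uK x)] add up to the identity. *)
have [t tE] : exists h : {linear P -> K}, forall x, i (h x) = x - v (u x).
  apply: (short_exact_factor
    (f := add_map (idmap P) (opp_map (comp_map v u))) ia) => x /=.
  by rewrite linearB vE /= uE /= sp subrr.
exists (pair_map uK i), (copair_map vK t) => x /=.
by apply: iI; rewrite linearD /= vKE tE uKE addrC subrK.
Qed.

(** In the inductive step A is covered by the projective P of B through [p] after [a]; Schanuel's
    lemma makes the new kernel a direct summand of K x P, to which the induction hypothesis
    applies. *)
Lemma syzygy_pdim_retract l A B : retract A B -> syzygy_pdim l B -> syzygy_pdim l A.
Proof.
elim: l A B => [|l IHl] A B rAB; first by move=> pB; apply: projective_retract rAB.
move=> [K [P [i [a [pP ia KP]]]]].
have [s [p sp]] := rAB; have [_ aS _] := ia.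
have paS : surjective_map (comp_map p a).
  by move=> x; have [y yE] := aS (s x); exists y; rewrite /= yE sp.
have kpa := short_exact_kernel paS.
eexists _, P, _, (comp_map p a); split=> //; first exact: kpa.
apply: IHl (schanuel_retract pP pP kpa ia rAB) _.
apply: syzygy_pdim_pair => //.
exact: syzygy_pdim_leq (leq0n l) _.
Qed.

(** The bound on a syzygy does not depend on the projective chosen: K is a direct summand of K' x P,
    where K' is the syzygy that witnesses the bound for M. *)
Lemma syzygy_pdim_kernel l M K P (i : {linear K -> P}) (a : {linear P -> M}) :
  projective P -> short_exact i a -> syzygy_pdim l.+1 M -> syzygy_pdim l K.
Proof.
move=> pP ia [K' [P' [i' [a' [pP' ia' KP']]]]].
apply: syzygy_pdim_retract (schanuel_retract pP pP' ia ia' (retract_refl M)) _.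
by apply: syzygy_pdim_pair => //; apply: syzygy_pdim_leq (leq0n l) _.
Qed.

Lemma pdim_leS l (M K P : lmodType R) (i : {linear K -> P}) (a : {linear P -> M}) :
  projective P -> short_exact i a -> pdim_le l K -> pdim_le l.+1 M.
Proof.
move=> pP [iI aS ex] [Q [d [b [pQ bS ex0 exS Q0]]]].
pose Q' j := if j is j'.+1 then Q j' else P.
pose d' j : {linear Q' j.+1 -> Q' j} :=
  match j with 0 => comp_map i b | j'.+1 => d j' end.
exists Q', d', a; split=> //.
- by case.
- move=> y; rewrite ex; split=> [[x <-]|[x <-]]; last by exists (b x).
  by have [z <-] := bS x; exists z.
- case=> [|j] /=; last exact: exS.
  move=> y; rewrite -[X in X <-> _]/(i (b y) = 0) -ex0; split=> [|->].
    by rewrite -[RHS](linear0 i) => /iI.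
  exact: linear0.
- by case.
Qed.

Lemma syzygy_pdim_le l M : syzygy_pdim l M <-> pdim_le l M.
Proof.
elim: l M => [|l IHl] M; split.
- move=> pM; pose Q j := if j is 0%N then M else zero_module R.
  have Q0 j : (0 < j)%N -> forall x : Q j, x = 0.
    by case: j => // j _; apply: zero_moduleP.
  exists Q, (fun j => zero_map _ _), (idmap M); split=> //.
  + by case=> [|j] //; apply/projective_zero/Q0.
  + by move=> x; exists x.
  + by move=> y; split=> [/= ->|[x /= <-] //]; exists 0.
  + by move=> j y; split=> // _; exists 0; rewrite (Q0 j.+1 _ y).
- move=> [P [d [a [pP aS ex0 exS P0]]]]; apply: (projective_retract (pP 0%N)).
  have aI : injective a.
    apply: raddf_inj => x /ex0[y <-].
    by rewrite (P0 1%N _ y) // linear0.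
  by have [] := bij_retract aI aS.
- move=> [K [P [i [a [pP ia /IHl KP]]]]].
  exact: pdim_leS pP ia KP.
move=> [P [d [a [pP aS ex0 exS P0]]]].
have ka := short_exact_kernel aS; have [iI _ ex] := ka.
eexists _, (P 0%N), _, a; split=> //; first exact: ka.
have [b bE] : exists h : {linear P 1%N -> submodule (lin_kernel_submod a)},
    forall x, submodule_incl _ (h x) = d 0%N x.
  by apply: short_exact_factor ka _ => x; apply/ex0; exists x.
apply/IHl; exists (fun j => P j.+1), (fun j => d j.+1), b; split=> //.
- move=> y; have /ex0[x xE] : a (submodule_incl _ y) = 0 by apply/ex; exists y.
  by exists x; apply: iI; rewrite bE.
- move=> y; rewrite -exS -bE; split=> [->|]; first exact: linear0.
  by rewrite -[RHS](linear0 (submodule_incl (lin_kernel_submod a))) => /iI.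
by move=> j lj; apply: P0.
Qed.

Lemma finite_pdimP M : finite_pdim M <-> exists l, syzygy_pdim l M.
Proof. by split=> -[l /syzygy_pdim_le]; exists l. Qed.

Lemma finite_pdim_projective P : projective P -> finite_pdim P.
Proof. by move=> pP; apply/finite_pdimP; exists 0%N. Qed.

Lemma finite_pdim_retract A B : retract A B -> finite_pdim B -> finite_pdim A.
Proof.
move=> r /finite_pdimP[l lB]; apply/finite_pdimP; exists l.
exact: syzygy_pdim_retract lB.
Qed.

Lemma finite_pdim_pair A B :
  finite_pdim A -> finite_pdim B -> finite_pdim (A * B)%type.
Proof.
move=> /finite_pdimP[l lA] /finite_pdimP[k kB].
apply/finite_pdimP; exists (maxn l k); apply: syzygy_pdim_pair.
  exact: syzygy_pdim_leq (leq_maxl _ _) lA.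
exact: syzygy_pdim_leq (leq_maxr _ _) kB.
Qed.

(** Cover B by P x P', using [f] after [a] on P and a lift [h] of [a'] along [g] on P'. The kernels
    of the three covers form a short exact sequence, a case of the snake lemma. *)
Lemma horseshoe A B C (f : {linear A -> B}) (g : {linear B -> C})
    K P (i : {linear K -> P}) (a : {linear P -> A})
    K' P' (i' : {linear K' -> P'}) (a' : {linear P' -> C}) :
    projective P' ->
    short_exact f g -> short_exact i a -> short_exact i' a' ->
  exists (N : lmodType R) (j : {linear N -> (P * P')%type})
      (b : {linear (P * P')%type -> B})
      (u : {linear K -> N}) (v : {linear N -> K'}),
    short_exact j b /\ short_exact u v.
Proof.
move=> pP' fg ia ia'.
have [fI gS ex] := fg; have [iI aS exi] := ia; have [iI' aS' exi'] := ia'.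
have [h hE] := pP' _ _ g a' gS.
have [b bE] : exists b : {linear (P * P')%type -> B},
    forall x, b x = f (a x.1) + h x.2.
  by exists (copair_map (comp_map f a) h).
have bS : surjective_map b.
  move=> y; have [z zE] := aS' (g y).
  have /ex[w wE] : g (y - h z) = 0 by rewrite linearB hE zE subrr.
  by have [x xE] := aS w; exists (x, z); rewrite bE xE wE subrK.
have jb := short_exact_kernel bS; have [jI _ exj] := jb.
set j := submodule_incl _ in jb jI exj.
have [u uE] : exists u : {linear K -> submodule (lin_kernel_submod b)},
    forall x, j (u x) = (i x, 0).
  apply: (short_exact_factor (f := pair_map i (zero_map K P')) jb) => x.
  by rewrite bE /= (short_exact_comp0 _ ia) !linear0 addr0.
have [v vE] : exists v : {linear submodule (lin_kernel_submod b) -> K'},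
    forall x, i' (v x) = (j x).2.
  apply: (short_exact_factor (f := comp_map (snd_map P P') j) ia') => x.
  have := congr1 g (short_exact_comp0 x jb).
  by rewrite bE linearD (short_exact_comp0 _ fg) add0r linear0 hE.
exists (submodule (lin_kernel_submod b)), j, b, u, v; split=> //; split.
- by move=> x y uxy; apply: iI; have := congr1 j uxy; rewrite !uE => -[].
- move=> y; have /ex[z zE] : g (h (i' y)) = 0.
    by rewrite hE (short_exact_comp0 _ ia').
  have [x xE] := aS z.
  have /exj[w wE] : b (- x, i' y) = 0 by rewrite bE !linearN xE zE addNr.
  by exists w; apply: iI'; rewrite vE wE.
move=> y; split=> [vy|[x <-]]; last by apply: iI'; rewrite vE uE linear0.
have := vE y; rewrite vy linear0; case E: (j y) => [x z] /= zE.
have /exi[w wE] : a x = 0.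
  apply: fI; have := short_exact_comp0 y jb.
  by rewrite E bE -zE !linear0 addr0.
by exists w; apply: jI; rewrite uE wE E zE.
Qed.

Lemma syzygy_pdim_extension l A B C (f : {linear A -> B}) (g : {linear B -> C}) :
  short_exact f g -> syzygy_pdim l A -> syzygy_pdim l C -> syzygy_pdim l B.
Proof.
elim: l A B C f g => [|l IHl] A B C f g fg.
  move=> pA pC; apply: projective_retract (projective_pair pA pC) _.
  have [fI gS ex] := fg; have [s sK] := projective_section pC gS.
  suff: retract (A * C)%type B /\ retract B (A * C)%type by case.
  apply: (bij_retract (f := copair_map f s)) => [|y].
    apply: raddf_inj => -[x z] /= xz.
    have z0 : z = 0.
      by have := congr1 g xz; rewrite linearD (short_exact_comp0 _ fg) sK add0r linear0.
    move: xz; rewrite z0 linear0 addr0 => fx; congr pair.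
    by apply: fI; rewrite fx linear0.
  have /ex[x xE] : g (y - s (g y)) = 0 by rewrite linearB sK subrr.
  by exists (x, g y); rewrite /= xE subrK.
move=> [K [P [i [a [pP ia KP]]]]] [K' [P' [i' [a' [pP' ia' KP']]]]].
have [N [j [b [u [v [jb uv]]]]]] := horseshoe pP' fg ia ia'.
exists N, (P * P')%type, j, b; split=> //; first exact: projective_pair.
exact: IHl uv _ _.
Qed.

Lemma finite_pdim_extension A B C (f : {linear A -> B}) (g : {linear B -> C}) :
  short_exact f g -> finite_pdim A -> finite_pdim C -> finite_pdim B.
Proof.
move=> fg /finite_pdimP[l lA] /finite_pdimP[k kC].
apply/finite_pdimP; exists (maxn l k); apply: (syzygy_pdim_extension fg).
  exact: syzygy_pdim_leq (leq_maxl _ _) lA.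
exact: syzygy_pdim_leq (leq_maxr _ _) kC.
Qed.

(* 0 -> ker a -> ker (g a) -> A -> 0 *)
Lemma kernel_comp_exact A B C P K (f : {linear A -> B}) (g : {linear B -> C})
    (i : {linear K -> P}) (a : {linear P -> B}) :
    short_exact f g -> short_exact i a ->
  exists (N : lmodType R) (j : {linear N -> P}) (u : {linear K -> N})
      (v : {linear N -> A}),
    short_exact j (comp_map g a) /\ short_exact u v.
Proof.
move=> fg ia; have [fI gS ex] := fg; have [iI aS exi] := ia.
have gaS : surjective_map (comp_map g a).
  by move=> z; have [y <-] := gS z; have [x <-] := aS y; exists x.
have jb := short_exact_kernel gaS; have [jI _ exj] := jb.
set j := submodule_incl _ in jb jI exj.
have [u uE] := short_exact_factor (f := i) jb
  (fun x => etrans (congr1 g (short_exact_comp0 x ia)) (linear0 g)).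
have [v vE] := short_exact_factor (f := comp_map a j) fg
  (fun x => short_exact_comp0 x jb).
exists (submodule (lin_kernel_submod (comp_map g a))), j, u, v; split=> //; split.
- by move=> x y uxy; apply: iI; rewrite -!uE uxy.
- move=> y; have [x xE] := aS (f y).
  have /exj[z zE] : comp_map g a x = 0 by rewrite /= xE (short_exact_comp0 _ fg).
  by exists z; apply: fI; rewrite vE -[LHS]/(a (j z)) zE xE.
move=> y; split=> [vy|[x <-]].
  have /exi[x xE] : a (j y) = 0 by rewrite -[LHS](vE y) vy linear0.
  by exists x; apply: jI; rewrite uE.
by apply: fI; rewrite vE -[LHS]/(a (j (u x))) uE (short_exact_comp0 _ ia) linear0.
Qed.

(** If P covers B, the kernel N of P -> B -> C is an extension of A by the syzygy of B. It has
    finite projective dimension and is a syzygy of C. *)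
Lemma finite_pdim_quotient A B C (f : {linear A -> B}) (g : {linear B -> C}) :
  short_exact f g -> finite_pdim A -> finite_pdim B -> finite_pdim C.
Proof.
(* Raising the bound by one ensures that it comes with a cover, also when B is projective. *)
move=> fg fA /finite_pdimP[l /syzygy_pdimS[K [P [i [a [pP ia KP]]]]]].
have [N [j [u [v [jb uv]]]]] := kernel_comp_exact fg ia.
have /finite_pdimP[k kN] : finite_pdim N.
  by apply: finite_pdim_extension uv _ fA; apply/finite_pdimP; exists l.
by apply/finite_pdimP; exists k.+1, N, P, j, (comp_map g a).
Qed.

(** The same extension read the other way: N is a syzygy of C, and A is the quotient of N by the
    syzygy of B. *)
Lemma finite_pdim_kernel A B C (f : {linear A -> B}) (g : {linear B -> C}) :
  short_exact f g -> finite_pdim B -> finite_pdim C -> finite_pdim A.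
Proof.
move=> fg /finite_pdimP[l /syzygy_pdimS[K [P [i [a [pP ia KP]]]]]].
move=> /finite_pdimP[k /syzygy_pdimS kC].
have [N [j [u [v [jb uv]]]]] := kernel_comp_exact fg ia.
apply: (finite_pdim_quotient uv); apply/finite_pdimP; first by exists l.
by exists k; apply: (syzygy_pdim_kernel pP jb).
Qed.

End ProjectiveDimension.

(** * Finiteness conditions *)

Section Submodules.
Variables (R : pzRingType) (M : lmodType R).
Implicit Types (N W : {pred M}).

Lemma submodZ N a x : submod_closed N -> x \in N -> a *: x \in N.
Proof.
by case=> N0 NN xN; rewrite -[_ *: _]addr0; apply: NN.
Qed.

Lemma submodD N x y : submod_closed N -> x \in N -> y \in N -> x + y \in N.
Proof. by case=> N0 NN xN yN; rewrite -[x]scale1r; apply: NN. Qed.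

Lemma submodB N x y : submod_closed N -> x \in N -> y \in N -> x - y \in N.
Proof.
by move=> sN xN yN; rewrite -scaleN1r; apply/submodD/submodZ.
Qed.

Lemma submod_comb N d (g : 'I_d -> M) c :
  submod_closed N -> (forall i, g i \in N) -> comb g c \in N.
Proof.
move=> sN gN; rewrite combE; elim/big_ind: _ => [|x y|i _].
- by case: sN.
- exact: submodD.
exact: submodZ.
Qed.

Lemma submod_linear_preim (A : lmodType R) (f : {linear A -> M}) N :
  submod_closed N -> submod_closed (fun x : A => f x \in N).
Proof.
move=> sN; split=> [|a x y]; rewrite ![_ \in (fun _ => _)]unfold_in.
  by rewrite linear0; case: sN.
by rewrite linearP; case: sN => _; apply.
Qed.

Definition addsub N W : {pred M} :=
  fun z => `[< exists x y, [/\ x \in N, y \in W & z = x + y] >].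

Lemma addsubP N W z :
  reflect (exists x y, [/\ x \in N, y \in W & z = x + y]) (z \in addsub N W).
Proof. exact: asboolP. Qed.

Lemma addsub_submod N W :
  submod_closed N -> submod_closed W -> submod_closed (addsub N W).
Proof.
move=> sN sW; split=> [|a x y].
  by apply/addsubP; exists 0, 0; split; [case: sN|case: sW|rewrite addr0].
move=> /addsubP[u [v [uN vW ->]]] /addsubP[u' [v' [uN' vW' ->]]].
apply/addsubP; exists (a *: u + u'), (a *: v + v'); split.
- by case: sN => _; apply.
- by case: sW => _; apply.
by rewrite scalerDr addrACA.
Qed.

Lemma addsubl N W : submod_closed W -> {subset N <= addsub N W}.
Proof.
by move=> [W0 _] x xN; apply/addsubP; exists x, 0; rewrite addr0.
Qed.

Lemma addsubr N W : submod_closed N -> {subset W <= addsub N W}.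
Proof.
by move=> [N0 _] x xW; apply/addsubP; exists 0, x; rewrite add0r.
Qed.

Lemma addsub_sub N W V : submod_closed V ->
  {subset N <= V} -> {subset W <= V} -> {subset addsub N W <= V}.
Proof.
by move=> sV NV WV x /addsubP[u [v [/NV uV /WV vV ->]]]; apply: submodD.
Qed.

Definition cyclic x : {pred M} := lin_image (scale_map x).
Lemma cyclicP x y : reflect (exists a, y = a *: x) (y \in cyclic x).
Proof.
by apply: (iffP (lin_imageP _ _)) => -[a aE]; exists a; rewrite ?aE // -aE.
Qed.
Lemma cyclic_submod x : submod_closed (cyclic x).
Proof. exact: lin_image_submod. Qed.
Lemma cyclic_sub N x : submod_closed N -> x \in N -> {subset cyclic x <= N}.
Proof. by move=> sN xN y /cyclicP[a ->]; apply: submodZ. Qed.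

(** Finite generation is stated for a bare predicate, so that no closure proof has to be carried
    along; [fg_subP] compares it with the submodule taken as a module. *)
Definition fg_sub N := exists (F : lmodType R) (g : {linear F -> M}),
  finitely_generated F /\ forall x, x \in N <-> exists c, g c = x.

Lemma fg_subP N (sN : submod_closed N) :
  fg_sub N <-> finitely_generated (submodule sN).
Proof.
split=> [[F [g [fgF gN]]]|fgN]; last first.
  exists (submodule sN), (submodule_incl sN); split=> // x.
  by split=> [|[y <-]]; [apply: submodule_lift | apply: submodule_inclP].
have gN' x : g x \in N by apply/gN; exists x.
apply: (fg_surj (f := corestr sN gN')) fgF => y.
have /gN[x xE] := submodule_inclP y.
by exists x; apply: submodule_incl_inj; rewrite corestrE.
Qed.

Lemma fg_sub_add N N1 N2 : fg_sub N1 -> fg_sub N2 ->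
    submod_closed N -> {subset N1 <= N} -> {subset N2 <= N} ->
    {subset N <= addsub N1 N2} -> fg_sub N.
Proof.
move=> [F1 [g1 [fg1 g1E]]] [F2 [g2 [fg2 g2E]]] sN N1N N2N N12.
exists (F1 * F2)%type, (copair_map g1 g2); split; first exact: fg_pair.
move=> x; split=> [/N12/addsubP[u [v [/g1E[c <-] /g2E[c' <-] ->]]]|[[c c'] <-]].
  by exists (c, c').
by apply: submodD => //; [apply/N1N/g1E; exists c | apply/N2N/g2E; exists c'].
Qed.

Lemma fg_sub_comb d (g : 'I_d -> M) : fg_sub (lin_image (comb g)).
Proof.
exists (free_module R d), (comb g); split; first exact: fg_free.
by move=> x; split=> /lin_imageP.
Qed.

Lemma fg_cyclic x : fg_sub (cyclic x).
Proof.
exists (free_module R 1), (comb (fun=> x)); split; first exact: fg_free.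
move=> y; split=> [/cyclicP[a ->]|[c <-]].
  by exists [ffun => a]; rewrite combE big_ord1 ffunE.
by apply/cyclicP; exists (c ord0); rewrite combE big_ord1.
Qed.

(** Zorn's lemma. It will provide maximal left ideals (with [x = 1]), maximal submodules of finitely
    generated modules (with [x] an indispensable generator) and a hyperplane of a vector space. *)
Lemma max_submod_avoiding N W x :
    submod_closed N -> submod_closed W -> {subset W <= N} -> x \notin W ->
  exists V : {pred M}, [/\ submod_closed V, {subset W <= V}, {subset V <= N},
    x \notin V & forall V' : {pred M}, submod_closed V' -> {subset V <= V'} ->
      {subset V' <= N} -> x \notin V' -> {subset V' <= V}].
Proof.
move=> sN sW WN xW.
pose p (A : set M) : {pred M} := fun y => `[< A y >].
have pP A y : y \in p A <-> A y by split=> [/asboolP|?] //; apply/asboolP.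
pose good A := [/\ submod_closed (p A), {subset W <= p A},
  {subset p A <= N} & x \notin p A].
(* The empty chain has the empty set as its union, so [P] has to admit it beside the good sets. *)
pose P A := A = set0 \/ good A.
have [F FP Ftot|A [PA Amax]] := @Zorn_bigcup _ P.
  have [[A FA [gA nA0]]|noA] :=
    pselect (exists2 A, F A & good A /\ exists y, A y); last first.
    left; apply/seteqP; split=> // y [A FA Ay]; apply: noA; exists A => //.
    by split; [case: (FP _ FA) => // A0; rewrite A0 in Ay | exists y].
  right; have Fgood B y : F B -> B y -> good B.
    by move=> /FP[->|].
  have [[A0 _] WA _ _] := gA.
  split.
  - split; first by apply/pP; exists A => //; apply/pP.
    move=> a y z /pP[B FB By] /pP[B' FB' Bz].
    have [sB _ _ _] := Fgood _ _ FB By; have [sB' _ _ _] := Fgood _ _ FB' Bz.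
    apply/pP; have [BB|BB] := Ftot _ _ FB FB'.
      exists B' => //; apply/pP; apply: submodD => //; last exact/pP.
      by apply: submodZ => //; apply/pP/BB.
    exists B => //; apply/pP; apply: submodD => //; last exact/pP/BB.
    by apply: submodZ => //; apply/pP.
  - by move=> y /WA/pP Ay; apply/pP; exists A.
  - by move=> y /pP[B FB By]; have [_ _ BN _] := Fgood _ _ FB By; apply/BN/pP.
  - apply/negP => /pP[B FB Bx]; have [_ _ _ /negP] := Fgood _ _ FB Bx; apply.
    exact/pP.
have gA : good A.
  case: PA => // A0; exfalso.
  have WE : forall y, y \in p (fun y => y \in W) <-> y \in W by move=> y; apply: pP.
  apply: (Amax (fun y => y \in W)).
    rewrite A0; split=> // /(_ 0); apply; by case: sW.
  right; split=> [|y||]; last by apply/negP => /WE; apply/negP.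
  - split; first by apply/WE; case: sW.
    by move=> a y z /WE yW /WE zW; apply/WE; case: sW => _; apply.
  - by move=> /WE.
  - by move=> y /WE/WN.
have [sA WA AN xA] := gA; exists (p A); split=> // V sV AV VN xV y yV.
apply: contrapT => yA; apply: (Amax (fun y => y \in V)).
  split=> [z Az|VA]; first by apply/AV/pP.
  by apply/yA/pP/VA.
have VE : forall y, y \in p (fun y => y \in V) <-> y \in V by move=> z; apply: pP.
right; split=> [|z||]; last by apply/negP => /VE; apply/negP.
- split; first by apply/VE; case: sV.
  by move=> a u z /VE uV /VE zV; apply/VE; case: sV => _; apply.
- by move=> /WA/AV/VE.
- by move=> z /VE/VN.
Qed.

End Submodules.

(** * Artinian modules, and finite generation over a commutative artinian ring *)

Section Artinian.
Variable R : pzRingType.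
Implicit Types (A B C M : lmodType R).

Definition artinian_module M : Prop :=
  forall I : nat -> {pred M},
    (forall i, submod_closed (I i)) ->
    (forall i, {subset I i.+1 <= I i}) ->
    exists l, forall i, (l <= i)%N -> I i =i I l.

Lemma decreasing_sub M (I : nat -> {pred M}) :
  (forall i, {subset I i.+1 <= I i}) ->
  forall i j, (i <= j)%N -> {subset I j <= I i}.
Proof.
move=> dI i j /subnK <-; elim: (j - i)%N => [|l IHl] // x.
by rewrite addSn => /dI/IHl.
Qed.

(** A descending chain in B is controlled by two traces: the preimages under [f] of [I i], and the
    preimages under [g] of [I i] + f(A). Once both are stationary, the modular law makes the chain
    stationary. *)
Lemma artinian_cover A B C (f : {linear A -> B}) (g : {linear C -> B}) :
    (forall b, exists a c, b = f a + g c) ->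
  artinian_module A -> artinian_module C -> artinian_module B.
Proof.
move=> fgS aA aC I sI dI.
have sF : submod_closed (lin_image f) by exact: lin_image_submod.
pose I1 i : {pred A} := fun x => f x \in I i.
pose I2 i : {pred C} := fun x => g x \in addsub (I i) (lin_image f).
have [l1 l1P] : exists l, forall i, (l <= i)%N -> I1 i =i I1 l.
  apply: aA => i; first exact: submod_linear_preim.
  by move=> x; apply: dI.
have [l2 l2P] : exists l, forall i, (l <= i)%N -> I2 i =i I2 l.
  apply: aC => i; first by apply: submod_linear_preim; apply: addsub_submod.
  move=> x; apply: (addsub_sub (addsub_submod (sI i) sF)); last exact: addsubr.
  by move=> y /dI; apply: addsubl.
exists (maxn l1 l2) => i; rewrite geq_max => /andP[li1 li2] x.
have lm : (maxn l1 l2 <= i)%N by rewrite geq_max li1.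
apply/idP/idP; first exact: decreasing_sub.
move=> xI; have [a [c xE]] := fgS x.
have fI y : f y \in I l1 -> f y \in I i.
  by have := l1P i li1 y; rewrite !unfold_in => ->.
have xI1 : x \in I l1 by apply: decreasing_sub xI; rewrite ?leq_maxl.
have xI2 : x \in I l2 by apply: decreasing_sub xI; rewrite ?leq_maxr.
have : c \in I2 i.
  rewrite (l2P i li2); apply/addsubP; exists x, (- f a).
  split=> //; last by rewrite xE addrAC subrr add0r.
  by apply/lin_imageP; exists (- a); rewrite linearN.
move=> /addsubP[y [_ [yI /lin_imageP[a' <-] cE]]].
have faE : x - y = f (a + a') by rewrite xE cE linearD [y + _]addrC !addrA addrK.
rewrite -(subrK y x); apply: submodD => //; rewrite faE; apply: fI.
rewrite -faE; apply: submodB => //.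
exact: decreasing_sub li1 _ yI.
Qed.

Lemma artinian_free d : artinian_module R^o -> artinian_module (free_module R d).
Proof.
move=> aR; elim: d => [|d IHd].
  move=> I sI dI; exists 0%N => i _ x; have -> : x = 0.
    by apply/ffunP => -[].
  by have [-> _] := sI i; have [-> _] := sI 0%N.
pose g : {linear R^o -> free_module R d.+1} := scale_map (free_gen R ord0).
pose f : {linear free_module R d -> free_module R d.+1} :=
  comb (fun i => free_gen R (lift ord0 i)).
apply: (artinian_cover (f := f) (g := g)) => // c.
exists [ffun i => c (lift ord0 i)], (c ord0).
rewrite {1}(free_moduleE c) big_ord_recl addrC combE.
by congr (_ + _); apply: eq_bigr => i _; rewrite ffunE.
Qed.

Lemma artinian_fg M :
  artinian_module R^o -> finitely_generated M -> artinian_module M.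
Proof.
move=> aR /finitely_generatedP[d [g gS]].
apply: (artinian_cover (f := g) (g := g)); try exact: artinian_free.
by move=> b; have [a <-] := gS b; exists a, 0; rewrite linear0 addr0.
Qed.

Lemma artinian_minimal M (P : {pred M} -> Prop) : artinian_module M ->
    (exists N : {pred M}, submod_closed N /\ P N) ->
  exists N : {pred M}, [/\ submod_closed N, P N &
    forall N' : {pred M}, submod_closed N' -> {subset N' <= N} -> P N' ->
      {subset N <= N'}].
Proof.
move=> aM [N0 [sN0 PN0]]; apply: contrapT => noN.
(* Where the premise fails, N' is N itself, so that [choice] gives a total function to iterate. *)
have step (N : {pred M}) : exists N' : {pred M}, submod_closed N /\ P N ->
    [/\ submod_closed N', {subset N' <= N}, P N' & ~ {subset N <= N'}].
  have [[sN PN]|] := pselect (submod_closed N /\ P N); last by exists N.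
  apply: contrapT => noN'; apply: noN; exists N; split=> // N' sN' N'N PN'.
  by apply: contrapT => NN'; apply: noN'; exists N'.
have [F FP] := choice step.
pose I i := iter i F N0.
have IP i : submod_closed (I i) /\ P (I i).
  by elim: i => [//|i IHi]; have [] := FP _ IHi.
have [l lP] : exists l, forall i, (l <= i)%N -> I i =i I l.
  by apply: aM => i; [have [] := IP i | have [] := FP _ (IP i)].
have [_ _ _] := FP _ (IP l); apply=> x.
by rewrite -[F _]/(I l.+1) lP.
Qed.

(** The chain of left ideals R c^i is stationary. *)
Lemma left_artinian_power (c : R) : left_artinian R ->
  exists l b, c ^+ l = b * c ^+ l.+1.
Proof.
move=> aR; pose I i : {pred R^o} := cyclic (c ^+ i : R^o).
have [l lP] : exists l, forall i, (l <= i)%N -> I i =i I l.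
  apply: aR => i; first exact: cyclic_submod.
  apply: cyclic_sub; first exact: cyclic_submod.
  by apply/cyclicP; exists c; rewrite exprS.
exists l; have : (c ^+ l : R^o) \in I l.+1.
  by rewrite lP //; apply/cyclicP; exists 1; rewrite scale1r.
by move=> /cyclicP.
Qed.

End Artinian.

(* A minimal submodule that is not finitely generated is annihilated or
   reproduced by every scalar, hence is a vector space over a quotient field of
   [k]; a hyperplane of it is finitely generated, so it is itself. *)
Lemma artinian_fg_sub (k : comPzRingType) (M : lmodType k) :
    left_artinian k -> artinian_module M ->
  forall N : {pred M}, submod_closed N -> fg_sub N.
Proof.
move=> ak aM N0 sN0; apply: contrapT => nfgN0.
have [N [sN nfgN Nmin]] := @artinian_minimal k M (fun N => ~ fg_sub N) aM
  (ex_intro _ N0 (conj sN0 nfgN0)).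
have fgN' (W : {pred M}) x : submod_closed W -> {subset W <= N} ->
    x \in N -> x \notin W -> fg_sub W.
  move=> sW WN xN /negP xW; apply: contrapT => nfgW.
  by apply/xW/(Nmin W).
have scaleC (a b : k) (x : M) : a *: (b *: x) = b *: (a *: x).
  by rewrite !scalerA mulrC.
have lin_scale a : linear (fun x : M => a *: x).
  by move=> b x y; rewrite scalerDr scaleC.
(* If both alternatives failed, the kernel K of [a] on N and the image aN would be proper submodules
   of N, hence finitely generated by minimality; so would be N, an extension of aN by K. *)
have dich a : (forall x, x \in N -> a *: x = 0) \/
    (forall x, x \in N -> exists2 y, y \in N & x = a *: y).
  apply: contrapT => /not_orP[/existsNP[u /not_implyP[uN au0]]].
  move=> /existsNP[v /not_implyP[vN noy]].
  pose am := linear_map (lin_scale a).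
  pose aN := lin_image (comp_map am (submodule_incl sN)).
  pose K : {pred M} := fun x => (x \in N) && (a *: x == 0).
  have KP x : x \in K <-> x \in N /\ a *: x = 0.
    by split=> [/andP[? /eqP]|[xN ax]] //; apply/andP; rewrite ax eqxx.
  have aNP x : x \in aN <-> exists2 y, y \in N & x = a *: y.
    split=> [/lin_imageP[y <-]|[y yN ->]].
      by exists (submodule_incl sN y) => //; apply: submodule_inclP.
    have [z zE] := submodule_lift sN yN.
    by apply/lin_imageP; exists z; rewrite -zE.
  have sK : submod_closed K.
    split=> [|b x y /KP[xN ax] /KP[yN ay]]; apply/KP.
      by rewrite scaler0; split=> //; apply: (proj1 sN).
    rewrite scalerDr scaleC ax ay scaler0 addr0; split=> //.
    by apply: (proj2 sN).
  have fgK : fg_sub K.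
    apply: (fgN' _ u) => // [x /KP[]//|].
    by apply/negP => /KP[].
  have [F [g [/finitely_generatedP[d [h hS]] gE]]] : fg_sub aN.
    apply: (fgN' _ v) => //; first exact: lin_image_submod.
      by move=> x /aNP[y yN ->]; apply: submodZ.
    by apply/negP => /aNP.
  have /choice[y yP] (i : 'I_d) :
      exists y, y \in N /\ a *: y = g (h (free_gen k i)).
    have /aNP[y yN gy] : g (h (free_gen k i)) \in aN.
      by apply/gE; exists (h (free_gen k i)).
    by exists y.
  have ay c : a *: comb y c = g (h c).
    apply: (@linear_free_eq k M d (comp_map am (comb y)) (comp_map g h)) => i.
    by rewrite -[LHS]/(a *: comb y _) comb_free_gen; case: (yP i).
  have combN c : comb y c \in N by apply: submod_comb => // i; case: (yP i).
  apply: nfgN; apply: (fg_sub_add (fg_sub_comb y) fgK) => //.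
  - by move=> x /lin_imageP[c <-].
  - by move=> x /KP[].
  move=> x xN; have /gE[w wE] : a *: x \in aN by apply/aNP; exists x.
  have [c cE] := hS w; apply/addsubP; exists (comb y c), (x - comb y c); split.
  - by apply/lin_imageP; exists c.
  - apply/KP; split; first exact: submodB.
    by rewrite scalerBr ay cE wE subrr.
  by rewrite addrC subrK.
have [x [xN x0]] : exists x, x \in N /\ x <> 0.
  apply: contrapT => noN; apply: nfgN.
  exists (free_module k 0), (zero_map _ M); split; first exact: fg_free.
  move=> x; split=> [xN|[c <-]]; last exact: (proj1 sN).
  exists 0; apply: contrapT => x0; apply: noN; exists x; split=> // xE.
  by apply: x0; rewrite xE.
pose Z : {pred M} := fun x => x == 0.
have sZ : submod_closed Z.
  split=> [|a y z /eqP -> /eqP ->]; first exact: eqxx.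
  by apply/eqP; rewrite scaler0 addr0.
(* W plays the role of the hyperplane; it remains to show N = W + k x. *)
have [||W [sW _ WN xW Wmax]] := max_submod_avoiding sN sZ (x := x).
- by move=> y /eqP ->; apply: (proj1 sN).
- exact/eqP.
have fgW : fg_sub W by apply: (fgN' W x).
apply: nfgN; apply: (fg_sub_add fgW (fg_cyclic x)) => //.
  exact: cyclic_sub.
move=> y yN; have [yW|yW] := boolP (y \in W).
  exact: addsubl (cyclic_submod x) _ yW.
have sWy := addsub_submod sW (cyclic_submod y).
have /addsubP[w [_ [wW /cyclicP[c ->] xE]]] : x \in addsub W (cyclic y).
  apply: contrapT => /negP xWy; move/negP: yW; apply.
  apply: (Wmax _ sWy _ _ xWy).
  - by apply: addsubl; apply: cyclic_submod.
  - by apply: addsub_sub => //; apply: cyclic_sub.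
  by apply: addsubr => //; apply/cyclicP; exists 1; rewrite scale1r.
have [c0|cS] := dich c.
  by case/negP: xW; rewrite xE c0 // addr0.
(* Since c N = N, y is c^l z for some z in N, and c^l = b c^(l+1) gives b (c y) = y: the scalar b
   inverts c on y. *)
have [l [b lb]] := left_artinian_power c ak.
have clS z : z \in N -> exists2 z', z' \in N & z = c ^+ l *: z'.
  elim: (l) z => [|j IHj] z zN; first by exists z; rewrite ?scale1r.
  have [z1 z1N ->] := cS z zN; have [z2 z2N ->] := IHj z1 z1N.
  by exists z2; rewrite // scalerA -exprS.
have [z zN yE] := clS y yN.
have yE' : y = b *: (c *: y) by rewrite {1}yE lb exprS -!scalerA -yE.
have cyE : c *: y = x - w by rewrite xE addrC addKr.
apply/addsubP; exists (- (b *: w)), (b *: x); split.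
- by rewrite -scaleNr; apply: submodZ.
- by apply/cyclicP; exists b.
by rewrite addrC {1}yE' cyE scalerBr.
Qed.

(** * Artin algebras *)

(** A synonym for [M] that keeps [f] in the type, so that the [k]-module structure can be attached
    to it. *)
Definition restrict (k A : pzRingType) (f : {rmorphism k -> A})
  (M : lmodType A) : Type := M.

Section RestrictionOfScalars.
Variables (k A : pzRingType) (f : {rmorphism k -> A}).
Local Notation restrict := (restrict f).

HB.instance Definition _ (M : lmodType A) := GRing.Zmodule.on (restrict M).

Section Action.
Variable M : lmodType A.
Definition restrict_scale (a : k) (x : restrict M) : restrict M :=
  f a *: (x : M).
Fact restrict_scalerA a b x :
  restrict_scale a (restrict_scale b x) = restrict_scale (a * b) x.
Proof. by rewrite /restrict_scale rmorphM scalerA. Qed.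
Fact restrict_scale1r : left_id 1 restrict_scale.
Proof. by move=> x; rewrite /restrict_scale rmorph1 scale1r. Qed.
Fact restrict_scalerDr : right_distributive restrict_scale +%R.
Proof. by move=> a x y; apply: scalerDr. Qed.
Fact restrict_scalerDl x : {morph restrict_scale^~ x : a b / a + b}.
Proof. by move=> a b; rewrite /restrict_scale rmorphD scalerDl. Qed.
HB.instance Definition _ := GRing.Zmodule_isLmodule.Build k (restrict M)
  restrict_scalerA restrict_scale1r restrict_scalerDr restrict_scalerDl.
End Action.

Lemma restrict_scaleE (M : lmodType A) (a : k) (x : M) :
  a *: (x : restrict M) = f a *: x.
Proof. by []. Qed.

Lemma restrict_map_linear (M N : lmodType A) (g : {linear M -> N}) :
  linear (g : restrict M -> restrict N).
Proof. by move=> a x y; rewrite !restrict_scaleE -linearP. Qed.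
Definition restrict_map (M N : lmodType A) (g : {linear M -> N}) :
  {linear restrict M -> restrict N} := linear_map (@restrict_map_linear M N g).

Lemma restrict_submod (M : lmodType A) (N : {pred M}) :
  submod_closed N -> submod_closed (N : {pred restrict M}).
Proof. by case=> N0 NN; split=> // a x y; apply: NN. Qed.

Lemma fg_of_restrict (M : lmodType A) :
  finitely_generated (restrict M) -> finitely_generated M.
Proof.
move=> [d [g gE]]; exists d, g => x; have [c xE] := gE x.
by exists (fun i => f (c i)).
Qed.

End RestrictionOfScalars.
Arguments restrict_map {k A} f {M N} g.

Lemma fg_cover (R : pzRingType) (A B C : lmodType R) (f : {linear A -> B})
    (g : {linear C -> B}) : (forall b, exists a c, b = f a + g c) ->
  finitely_generated A -> finitely_generated C -> finitely_generated B.
Proof.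
move=> fgS fgA fgC; apply: (fg_surj (f := copair_map f g)); last exact: fg_pair.
by move=> b; have [a [c ->]] := fgS b; exists (a, c).
Qed.

(** Commutative artinian rings are noetherian: the image of [f] is a submodule of an artinian
    module, so [artinian_fg_sub] applies to it. *)
Lemma fg_inj (k : comPzRingType) (A B : lmodType k) (f : {linear A -> B}) :
  left_artinian k -> injective f -> finitely_generated B -> finitely_generated A.
Proof.
move=> ak fI fgB; have sF := lin_image_submod f.
have /(fg_subP sF) : fg_sub (lin_image f).
  by apply: artinian_fg_sub => //; apply: artinian_fg.
have [|h hE] := inj_factor (f := submodule_incl sF) fI.
  by move=> x; apply/lin_imageP/submodule_inclP.
apply: (fg_surj (f := h)) => // x.
have [|y yE] := submodule_lift sF (x := f x); first by apply/lin_imageP; exists x.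
by exists y; apply: fI; rewrite hE yE.
Qed.

Section ArtinAlgebra.
Variables (k : comPzRingType) (A : pzRingType) (f : {rmorphism k -> A}).

(** [artin_algebra] with its ground ring and structure map fixed, so that L and its corner can be
    treated over the same [k]. *)
Definition artin_algebra_over : Prop :=
  [/\ left_artinian k, forall (a : k) (x : A), f a * x = x * f a
    & finitely_generated (restrict f A^o)].

Hypothesis artinA : artin_algebra_over.

Lemma fg_restrict (M : lmodType A) :
  finitely_generated M -> finitely_generated (restrict f M).
Proof.
move=> /finitely_generatedP[d [g gS]].
apply: (fg_surj (f := restrict_map f g)) => // {g gS M}.
have [_ _ fgA] := artinA; elim: d => [|d IHd].
  by apply: fg_zero => x; apply/ffunP => -[].
apply: (fg_cover (f := restrict_map f (comb (fun i => free_gen A (lift ord0 i))))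
  (g := restrict_map f (scale_map (free_gen A ord0)))) => // c.
exists [ffun i => c (lift ord0 i)], (c ord0).
rewrite {1}(free_moduleE c) big_ord_recl addrC.
by congr (_ + _); apply: eq_bigr => i _; rewrite ffunE.
Qed.

Lemma artin_fg_inj (M N : lmodType A) (g : {linear M -> N}) :
  injective g -> finitely_generated N -> finitely_generated M.
Proof.
have [ak _ _] := artinA.
move=> gI /fg_restrict fgN; apply: (@fg_of_restrict _ _ f).
exact: (fg_inj (f := restrict_map f g)).
Qed.

Lemma artin_fg_submodule (M : lmodType A) (N : {pred M}) (sN : submod_closed N) :
  finitely_generated M -> finitely_generated (submodule sN).
Proof. exact/artin_fg_inj/submodule_incl_inj. Qed.

Lemma artin_artinian (M : lmodType A) :
  finitely_generated M -> artinian_module M.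
Proof.
have [ak _ _] := artinA.
move=> /fg_restrict fgM I sI dI.
by apply: (artinian_fg ak fgM) => // i; apply: restrict_submod.
Qed.

Lemma artin_left_power (a : A) : exists l b, forall n,
  (l <= n)%N -> a ^+ n = b * a ^+ n.+1.
Proof.
have aA : left_artinian A.
  apply: artin_artinian; have [_ _ fgA] := artinA; exact: fg_of_restrict fgA.
have [l [b lb]] := left_artinian_power a aA; exists l, b => n ln.
by rewrite -{1}(subnKC ln) exprD lb -mulrA -exprD addSn subnKC.
Qed.

(** The right ideals a^i A are [k]-submodules of A because the image of [k] is central, so their
    descending chain is stationary too. *)
Lemma artin_right_power (a : A) : exists l c, forall n,
  (l <= n)%N -> a ^+ n = a ^+ n.+1 * c.
Proof.
have [ak cA fgA] := artinA.
pose I i : {pred restrict f A^o} := fun x => `[< exists c : A, x = a ^+ i * c >].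
have [l lP] : exists l, forall i, (l <= i)%N -> I i =i I l.
  apply: (artinian_fg ak fgA) => i.
    split=> [|c x y /asboolP[r ->] /asboolP[s ->]]; apply/asboolP.
      by exists 0; rewrite mulr0.
    exists (f c * r + s); rewrite mulrDr; congr (_ + _).
    by rewrite -[LHS]/(f c * (a ^+ i * r)) mulrA cA -!mulrA cA.
  move=> x /asboolP[r ->]; apply/asboolP.
  by exists (a * r); rewrite mulrA -exprSr.
exists l; have : (a ^+ l : restrict f A^o) \in I l.+1.
  by rewrite lP //; apply/asboolP; exists 1; rewrite mulr1.
move=> /asboolP[c ac]; exists c => n ln.
by rewrite -{1}(subnK ln) exprD {1}ac mulrA -exprD addnS subnK.
Qed.

(** Iterating both stationarity relations doubles the exponent. The exponent is a successor so that
    the power is fixed on both sides by any q with q a = a = a q. *)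
Lemma strongly_pi_regular (a : A) : exists n b c,
  a ^+ n.+1 = b * a ^+ n.+1 ^+ 2 /\ a ^+ n.+1 = a ^+ n.+1 ^+ 2 * c.
Proof.
have [l [b lb]] := artin_left_power a; have [m [c mc]] := artin_right_power a.
pose n := maxn l m.
have bP j i : (l <= i)%N -> a ^+ i = b ^+ j * a ^+ (j + i).
  move=> li; elim: j => [|j IHj]; first by rewrite mul1r.
  by rewrite exprSr -mulrA -lb // (leq_trans li) ?leq_addl.
have cP j i : (m <= i)%N -> a ^+ i = a ^+ (j + i) * c ^+ j.
  move=> mi; elim: j => [|j IHj]; first by rewrite mulr1.
  by rewrite exprS mulrA -mc // (leq_trans mi) ?leq_addl.
have ln : (l <= n.+1)%N by rewrite leqW ?leq_maxl.
have mn : (m <= n.+1)%N by rewrite leqW ?leq_maxr.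
exists n, (b ^+ n.+1), (c ^+ n.+1).
by rewrite -exprM muln2 -addnn -bP // -cP.
Qed.

(* Fitting's lemma for the endomorphism ring of [A q]. *)
Lemma primitive_nilpotent_or_unit (q a : A) : primitive_idempotent q ->
    q * a = a -> a * q = a ->
  (exists n, a ^+ n = 0) \/ (exists r, q = r * a).
Proof.
move=> [qq q0 qprim] qa aq; have [n [b [c [ub uc]]]] := strongly_pi_regular a.
set u := a ^+ n.+1 in ub uc.
have qu : q * u = u by rewrite /u exprS mulrA qa.
have uq : u * q = u by rewrite /u exprSr -mulrA aq.
have bu_uc : b * u = u * c by rewrite {1}uc mulrA -ub.
(* [h = b u = u c] is an idempotent of q A q, so primitivity of q makes it 0 or q. In the first case
   u = h u vanishes; in the second q = b a^n a. *)
pose h := b * u.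
have hu : h * u = u by rewrite /h -mulrA -expr2 -ub.
have hh : h * h = h by rewrite {2}/h bu_uc mulrA hu -bu_uc.
have qh : q * h = h by rewrite /h bu_uc mulrA qu.
have hq : h * q = h by rewrite /h -mulrA uq.
have [||||h0|hE] := qprim h (q - h) hh.
- by rewrite mulrBl !mulrBr qq qh hq hh subrr subr0.
- by rewrite mulrBr hq hh subrr.
- by rewrite mulrBl qh hh subrr.
- by rewrite addrC subrK.
- by left; exists n.+1; rewrite -/u -hu h0 mul0r.
right; exists (b * a ^+ n); rewrite -mulrA -exprSr -/u -/h.
by apply/eqP; rewrite -subr_eq0 hE.
Qed.

(** A q is local: its proper submodules lie in J q. If y missed a maximal left ideal I, then 1 would
    be congruent to r y modulo I for some r. Either q r y is nilpotent, hence so is r y, which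
    forces 1 into I; or q is a left multiple of y and lies in K. *)
Lemma proper_sub_jacobson (q : A) (K : {pred A^o}) (y : A) :
    primitive_idempotent q -> submod_closed K -> q \notin K ->
  (y : A^o) \in K -> y * q = y -> y \in jacobson A.
Proof.
move=> pq sK qK yK yq; apply/jacobsonP => I [sI I1 Imax].
apply: contrapT => /negP yI; have qq : q * q = q by case: pq.
have sy := cyclic_submod (y : A^o).
have /addsubP[i [_ [iI /cyclicP[r ->] E1]]] :
    (1 : A^o) \in addsub I (cyclic (y : A^o)).
  apply: contrapT => /negP n1; case/negP: yI.
  apply: (Imax _ (addsub_submod sI sy) _ n1).
    exact: addsubl.
  by apply: addsubr => //; apply/cyclicP; exists 1; rewrite scale1r.
pose a := q * r * y.
have [||[n an]|[s qs]] := primitive_nilpotent_or_unit (a := a) pq.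
- by rewrite /a !mulrA qq.
- by rewrite /a -mulrA yq.
- have ryE j : (r * y) ^+ j.+1 = r * y * a ^+ j.
    elim: j => [|j IHj]; first by rewrite mulr1.
    have ya : r * y * a = r * y * (r * y).
      by rewrite /a -!mulrA [y * (q * _)]mulrA yq.
    by rewrite exprS IHj [a ^+ j.+1]exprS mulrA -ya -!mulrA.
  have ryI j : (1 - (r * y) ^+ j : A^o) \in I.
    elim: j => [|j IHj]; first by rewrite subrr; case: sI.
    have -> : 1 - (r * y) ^+ j.+1 = (r * y) ^+ j * (1 - r * y) + (1 - (r * y) ^+ j).
      by rewrite mulrBr mulr1 -exprSr [RHS]addrC addrA subrK.
    apply: submodD => //; apply: (submodZ (M := A^o)) => //.
    by rewrite {1}E1 -[r *: (y : A^o)]/(r * y) addrK.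
  by case/negP: I1; have := ryI n.+1; rewrite ryE an mulr0 subr0.
case/negP: qK; rewrite qs /a mulrA; exact: (submodZ (M := A^o)).
Qed.

End ArtinAlgebra.

(** A form of Nakayama's lemma: otherwise the left ideal of all r with r y in V is proper, and a
    maximal left ideal above it contains both 1 - j and j. *)
Lemma jacobson_cancel (A : pzRingType) (M : lmodType A) (V : {pred M})
    (j : A) (y : M) :
  submod_closed V -> j \in jacobson A -> y - j *: y \in V -> y \in V.
Proof.
move=> sV /jacobsonP Jj yE; apply: contrapT => /negP yV.
pose T : {pred A^o} := xpredT.
have sK := submod_linear_preim (scale_map y) sV.
have [|||I [sI KI _ I1 Imax]] := @max_submod_avoiding A A^o T _ 1 _ sK.
- by [].
- by [].
- by rewrite unfold_in -[X in X \in V]/(1 *: y) scale1r.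
have jI : j \in I by apply: Jj; split=> // K sK' IK K1; apply: Imax.
case/negP: I1; rewrite -(subrK j 1); apply: submodD => //; apply: KI.
by rewrite unfold_in -[X in X \in V]/((1 - j) *: y) scalerBl scale1r.
Qed.

(** * Modules killed by an idempotent *)

Lemma quot_proj_linear (R : pzRingType) (M : lmodType R) (N : {pred M})
    (sN : submod_closed N) : linear (quot_proj sN).
Proof.
move=> a x y.
have projD : {morph quot_proj sN : u v / u + v}.
  by move=> u v; apply: (raddfD (\pi_(Quotient.quot (submod_zmodClosed sN))%qT)).
rewrite projD; congr (_ + _).
rewrite -[RHS]/(quot_proj sN (a *:
  repr (quot_proj sN x : Quotient.quot (submod_zmodClosed sN)))).
apply/quot_projE; rewrite -scalerBr; apply: submodZ => //.
by apply/quot_projE; rewrite /quot_proj reprK.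
Qed.
Definition quot_map (R : pzRingType) (M : lmodType R) (N : {pred M})
  (sN : submod_closed N) : {linear M -> quot_module sN} :=
  linear_map (quot_proj_linear sN).

Lemma quot_short_exact (R : pzRingType) (M : lmodType R) (N : {pred M})
  (sN : submod_closed N) : short_exact (submodule_incl sN) (quot_map sN).
Proof.
have quotP x : quot_map sN x = 0 <-> x \in N.
  have := quot_projE sN x 0; rewrite subr0 => <-.
  by rewrite -[quot_proj sN 0]/(quot_map sN 0) linear0.
split=> [x y|u|x]; first exact: submodule_incl_inj.
  by exists (repr (u : Quotient.quot (submod_zmodClosed sN))); apply: reprK.
rewrite quotP; split=> [|[y <-]]; first exact: submodule_lift.
exact: submodule_inclP.
Qed.

(** The last clause expresses simplicity of N/V without forming the quotient. Generators are dropped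
    until one, y, lies outside the span W of the others; a submodule maximal among those between W
    and N that avoid y is then a maximal submodule of N = W + R y. *)
Lemma fg_sub_maximal (R : pzRingType) (M : lmodType R) (N : {pred M}) (x : M) :
    submod_closed N -> fg_sub N -> x \in N -> x != 0 ->
  exists V : {pred M}, [/\ submod_closed V, {subset V <= N},
    exists2 y, y \in N & y \notin V &
    forall z, z \in N -> z \notin V -> {subset N <= addsub V (cyclic z)}].
Proof.
move=> sN [F [g [/finitely_generatedP[d [h hS]] gN]]] xN x0.
have [w Ng] : exists w : 'I_d -> M, forall z, z \in N <-> exists c, comb w c = z.
  exists (fun i => g (h (free_gen R i))) => z.
  have eqg := linear_free_eq (f := comb (fun i => g (h (free_gen R i))))
    (g := comp_map g h) (comb_free_gen _).
  rewrite gN; split=> [[u <-]|[c <-]]; last by exists (h c); rewrite eqg.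
  by have [c <-] := hS u; exists c; rewrite eqg.
have [W [y [sW WN yN yW NWy]]] : exists (W : {pred M}) y,
  [/\ submod_closed W, {subset W <= N}, y \in N, y \notin W &
    {subset N <= addsub W (cyclic y)}].
  clear h hS gN; elim: d w Ng => [|d IHd] {}g Ng.
    have /Ng[c xE] := xN; case/eqP: x0; rewrite -xE.
    by rewrite combE big_ord0.
  pose W := lin_image (comb (fun i => g (lift ord0 i))).
  have sW : submod_closed W by exact: lin_image_submod.
  have gi i : g i \in N by apply/Ng; exists (free_gen R i); rewrite comb_free_gen.
  have WN : {subset W <= N} by move=> z /lin_imageP[c <-]; apply: submod_comb.
  have [gW|gW] := boolP (g ord0 \in W); last first.
    exists W, (g ord0); split=> // z /Ng[c <-].
    rewrite combE big_ord_recl addrC; apply/addsubP.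
    exists (\sum_(i < d) (c (lift ord0 i) : R) *: g (lift ord0 i)), ((c ord0 : R) *: g ord0).
    split=> //; last by apply/cyclicP; exists (c ord0).
    apply/lin_imageP; exists [ffun i => c (lift ord0 i)].
    by rewrite combE; apply: eq_bigr => i _; rewrite ffunE.
  apply: IHd (fun i => g (lift ord0 i)) _ => z; split=> [/Ng[c <-]|[c <-]]; last first.
    by apply: submod_comb.
  apply/lin_imageP; rewrite combE big_ord_recl; apply: submodD => //.
    exact: submodZ.
  apply/lin_imageP; exists [ffun i => c (lift ord0 i)].
  by rewrite combE; apply: eq_bigr => i _; rewrite ffunE.
have [V [sV WV VN yV Vmax]] := max_submod_avoiding sN sW WN yW.
exists V; split=> //; first by exists y.
move=> z zN zV u uN; have sz := cyclic_submod z.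
have sVz := addsub_submod sV sz.
have VVz := addsubl (N := V) sz.
have yVz : y \in addsub V (cyclic z).
  apply: contrapT => /negP yVz; case/negP: zV; apply: (Vmax _ sVz VVz _ yVz).
    by apply: addsub_sub => //; apply: cyclic_sub.
  by apply: addsubr => //; apply/cyclicP; exists 1; rewrite scale1r.
have := NWy u uN; apply: addsub_sub => //; last exact: cyclic_sub.
by move=> v /WV/VVz.
Qed.

Section LeftPrincipal.
Variables (L : pzRingType) (q : L).

Lemma lprincipal_val_linear : linear (@lprincipal_val L q).
Proof. by []. Qed.
Definition lprincipal_incl : {linear lprincipal q -> L^o} :=
  linear_map lprincipal_val_linear.

Fact mem_lprincipal (r : L) : (r * q : L^o) \in lprincipal_pred q.
Proof. by apply/asboolP; exists r. Qed.

Lemma lprincipal_valM (r : lprincipal q) :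
  q * q = q -> (lprincipal_val r : L) * q = lprincipal_val r.
Proof. by move=> qq; have /asboolP[s ->] := valP r; rewrite -mulrA qq. Qed.

Lemma projective_lprincipal : q * q = q -> projective (lprincipal q).
Proof.
move=> qq; apply: (projective_retract (@projective_free L 1)).
exists (comp_map (scale_map (free_gen L ord0)) lprincipal_incl).
exists (comb (fun=> Lprincipal (mem_lprincipal 1))) => r; apply: val_inj.
rewrite combE big_ord1 /= !ffunE eqxx.
by rewrite /GRing.scale /= mulr1 mul1r lprincipal_valM.
Qed.

End LeftPrincipal.

Section KilledByIdempotent.
Variables (k : comPzRingType) (L : pzRingType) (f : {rmorphism k -> L}).
Hypothesis artinL : artin_algebra_over f.

(* [0 -> J q -> V x L q -> N -> 0] *)
Lemma finite_pdim_maximal (M : lmodType L) (V N : {pred M})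
    (sV : submod_closed V) (sN : submod_closed N) (q : L) (y : M) :
    {subset V <= N} ->
    (forall z, z \in N -> z \notin V -> {subset N <= addsub V (cyclic z)}) ->
    y \in N -> y \notin V -> q *: y = y ->
    primitive_idempotent q -> finite_pdim (simple_top q) ->
  finite_pdim (submodule sV) -> finite_pdim (submodule sN).
Proof.
move=> VN Vmax yN yV qy pq fpd_top fpdV; have [qq _ _] := pq.
have pLq := projective_lprincipal qq.
pose sJ := rad_lprincipal_submod q.
have fpdJ : finite_pdim (submodule sJ).
  apply: (finite_pdim_kernel (quot_short_exact sJ)) => //.
  exact: finite_pdim_projective.
(* Were j y outside V, then y = v + r (j y) with v in V, and Nakayama would put y in V. *)
have JV (j : L) : j \in jacobson L -> j *: y \in V.
  move=> jJ; apply: contrapT => /negP jyV.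
  have /addsubP[v [_ [vV /cyclicP[r ->] yE]]] := Vmax _ (submodZ j sN yN) jyV y yN.
  case/negP: yV; apply: (jacobson_cancel sV (jacobson_mull r jJ)).
  by rewrite {1}yE scalerA addrK.
(* The r with r y in V form a left ideal that misses q, since q y = y; by locality of L q, those in
   L q lie in J. *)
have KJ (r : L) : r * q = r -> r *: y \in V -> r \in jacobson L.
  have sK := submod_linear_preim (scale_map y) sV.
  move=> rq ryV; apply: (proper_sub_jacobson artinL pq sK) rq => //.
  by rewrite unfold_in -[X in X \in V]/(q *: y) qy.
have JVq (r : submodule sJ) :
    comp_map (scale_map y) (comp_map (lprincipal_incl q) (submodule_incl sJ)) r \in V.
  have /asboolP[j jJ rE] := submodule_inclP r.
  rewrite -[X in X \in V]/((val (submodule_incl sJ r) : L) *: y) rE -scalerA qy.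
  exact: JV.
(* The maps are s |-> (s y, -s) and (v, r) |-> v + r y; [JV] and [KJ] together say that r |-> r y
   from L q to N/V has kernel J q. *)
pose i := pair_map (corestr sV JVq) (opp_map (submodule_incl sJ)).
have VNq (x : submodule sV * lprincipal q) : copair_map (submodule_incl sV)
    (comp_map (scale_map y) (lprincipal_incl q)) x \in N.
  apply: submodD => //; first exact/VN/submodule_inclP.
  exact: submodZ.
pose b := corestr sN VNq.
have bE v (r : lprincipal q) : submodule_incl sN (b (v, r)) =
  submodule_incl sV v + (val r : L) *: y by [].
have ib : short_exact i b.
  split.
  - move=> r s /(congr1 snd)/oppr_inj; exact: submodule_incl_inj.
  - move=> z; have := Vmax y yN yV _ (submodule_inclP z).
    move=> /addsubP[_ [_ [/(submodule_lift sV)[v <-] /cyclicP[r ->] zE]]].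
    exists (v, Lprincipal (mem_lprincipal q r)).
    by apply: submodule_incl_inj; rewrite bE zE /= -scalerA qy.
  - move=> [v r]; split=> [bvr|[s <-]]; last first.
      apply: submodule_incl_inj; rewrite bE linear0.
      rewrite -[submodule_incl sV _]/((val (submodule_incl sJ s) : L) *: y).
      by rewrite raddfN scaleNr subrr.
    have := bE v r; rewrite bvr linear0 => /esym/eqP; rewrite addr_eq0 => /eqP vE.
    have rJ : - r \in @rad_lprincipal L q.
      apply/asboolP; exists (- (val r : L)).
        rewrite -mulN1r; apply/jacobson_mull/KJ; first exact: lprincipal_valM.
        by rewrite -[X in X \in V]opprK -vE -scaleN1r; apply/submodZ/submodule_inclP.
      by rewrite raddfN mulNr lprincipal_valM.
    have [s sE] := submodule_lift sJ rJ; exists s.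
    congr pair; last by rewrite -[LHS]/(- submodule_incl sJ s) sE opprK.
    apply: submodule_incl_inj; rewrite vE.
    rewrite -[LHS]/((val (submodule_incl sJ s) : L) *: y) sE raddfN.
    by rewrite scaleNr.
apply: (finite_pdim_quotient ib) => //.
by apply: finite_pdim_pair => //; apply: finite_pdim_projective.
Qed.

Variables (n : nat) (eps : 'I_n -> L).
Hypothesis heps : complete_orth_primitive eps.
Variables (m : nat) (e : L).
Hypothesis he : e = \sum_(i < n | (i < m)%N) eps i.
Hypothesis hsimple :
  forall i : 'I_n, ~ finite_pdim (simple_top (eps i)) -> (i < m)%N.

(** A minimal submodule N of infinite projective dimension has a maximal submodule V of finite
    projective dimension. As the [eps i] sum to 1, some [eps i] moves an element of N to one outside
    V; as e kills M, this i is not below m, so its simple top has finite projective dimension. *)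
Lemma finite_pdim_killed (M : lmodType L) :
  finitely_generated M -> (forall x : M, e *: x = 0) -> finite_pdim M.
Proof.
move=> fgM eM; apply: contrapT => nfpdM.
have [prim orth one] := heps.
pose P (N : {pred M}) := exists sN : submod_closed N, ~ finite_pdim (submodule sN).
have [|N [_ [sN nfpdN] Nmin]] := artinian_minimal (P := P) (artin_artinian artinL fgM).
  have sT : submod_closed (xpredT : {pred M}) by [].
  exists xpredT; split=> //; exists sT; apply: contra_not nfpdM.
  apply: finite_pdim_retract.
  by exists (corestr sT (f := idmap M) (fun=> isT)), (submodule_incl sT).
have [x xN x0] : exists2 x, x \in N & x != 0.
  apply: contrapT => noN; apply: nfpdN; apply: finite_pdim_projective.
  apply: projective_zero => x; apply: submodule_incl_inj; rewrite linear0.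
  apply: contrapT => /eqP x0; apply: noN; exists (submodule_incl sN x) => //.
  exact: submodule_inclP.
have fgN : fg_sub N by apply/(fg_subP sN)/(artin_fg_submodule artinL).
have [V [sV VN [z zN zV] Vmax]] := fg_sub_maximal sN fgN xN x0.
have [i yV] : exists i, eps i *: z \notin V.
  apply: contrapT => noi; case/negP: zV; rewrite -[z]scale1r -one scaler_suml.
  elim/big_ind: _ => [|u v|i _]; [by case: sV | exact: submodD |].
  by apply: contrapT => /negP iV; apply: noi; exists i.
have ii : eps i * eps i = eps i by case: (prim i).
have im : ~~ (i < m)%N.
  apply/negP => im; case/negP: yV.
  have eE : eps i * e = eps i.
    rewrite he mulr_sumr (bigD1 i) //= ii big1 ?addr0 // => j /andP[_ ji].
    by rewrite orth // eq_sym.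
  by rewrite -eE -scalerA eM scaler0; case: sV.
apply: nfpdN; apply: (@finite_pdim_maximal _ V N sV sN (eps i) _ VN Vmax _ yV) => //.
- exact: submodZ.
- by rewrite scalerA ii.
- by apply: contrapT => /hsimple; apply/negP.
apply: contrapT => nfpdV; case/negP: zV; apply: (Nmin V) => //.
by exists sV.
Qed.

End KilledByIdempotent.

(** * The corner functor *)

(** e M is encoded by the fixed points of e, which makes membership an equation. *)
Definition corner_part_pred (L : pzRingType) (e : idempotent_elt L)
  (M : lmodType L) : {pred M} := fun x => idem_val e *: x == x.
Arguments corner_part_pred {L} e M.

Record corner_part (L : pzRingType) (e : idempotent_elt L) (M : lmodType L) :=
  CornerPart { corner_part_val : M; _ : corner_part_val \in corner_part_pred e M }.

Section CornerPart.
Variables (L : pzRingType) (e : idempotent_elt L).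
Local Notation C := (corner e).
Local Notation eL := (idem_val e).

Section Structure.
Variable M : lmodType L.
Local Notation eM := (corner_part e M).

Lemma corner_partP x : reflect (eL *: x = x) (x \in corner_part_pred e M).
Proof. exact: eqP. Qed.

Fact corner_part_zmod : zmod_closed (corner_part_pred e M).
Proof.
split=> [|x y /corner_partP ex /corner_partP ey]; apply/corner_partP.
  exact: scaler0.
by rewrite scalerBr ex ey.
Qed.

HB.instance Definition _ := [isSub for @corner_part_val L e M].
HB.instance Definition _ := [Choice of eM by <:].
HB.instance Definition _ := GRing.SubChoice_isSubZmodule.Build M _ eM
  corner_part_zmod.

Lemma corner_part_valE (x : eM) : eL *: corner_part_val x = corner_part_val x.
Proof. exact/corner_partP/(valP x). Qed.

Lemma corner_valE (c : C) : eL * val c = val c.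
Proof. exact: peirce_idl. Qed.

Fact corner_scale_subproof (c : C) (x : eM) :
  val c *: corner_part_val x \in corner_part_pred e M.
Proof. by apply/corner_partP; rewrite scalerA corner_valE. Qed.

Definition corner_scale (c : C) (x : eM) : eM :=
  CornerPart (corner_scale_subproof c x).

Fact corner_scalerA a b x :
  corner_scale a (corner_scale b x) = corner_scale (a * b) x.
Proof. by apply: val_inj; rewrite /= scalerA. Qed.
Fact corner_scale1r : left_id 1 corner_scale.
Proof. by move=> x; apply: val_inj; apply: corner_part_valE. Qed.
Fact corner_scalerDr : right_distributive corner_scale +%R.
Proof. by move=> a x y; apply: val_inj; apply: scalerDr. Qed.
Fact corner_scalerDl x : {morph corner_scale^~ x : a b / a + b}.
Proof. by move=> a b; apply: val_inj; apply: scalerDl. Qed.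
HB.instance Definition _ := GRing.Zmodule_isLmodule.Build C eM
  corner_scalerA corner_scale1r corner_scalerDr corner_scalerDl.

Lemma corner_part_scaleE (c : C) (x : eM) :
  corner_part_val (c *: x) = val c *: corner_part_val x.
Proof. by []. Qed.

Lemma corner_part_val_inj : injective (@corner_part_val L e M).
Proof. exact: val_inj. Qed.

Lemma corner_part_valD (x y : eM) :
  corner_part_val (x + y) = corner_part_val x + corner_part_val y.
Proof. by []. Qed.

Fact corner_part_mem (x : M) : eL *: x \in corner_part_pred e M.
Proof. by apply/corner_partP; rewrite scalerA idemP. Qed.
Definition corner_proj (x : M) : eM := CornerPart (corner_part_mem x).

Lemma corner_proj_val (x : eM) : corner_proj (corner_part_val x) = x.
Proof. by apply: val_inj; apply: corner_part_valE. Qed.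

End Structure.

Section Functor.
Implicit Types A B D M N : lmodType L.

Section Map.
Variables (M N : lmodType L) (g : {linear M -> N}).
Fact corner_map_subproof (x : corner_part e M) :
  g (corner_part_val x) \in corner_part_pred e N.
Proof. by apply/corner_partP; rewrite -linearZ corner_part_valE. Qed.
Fact corner_map_linear : linear (fun x => CornerPart (corner_map_subproof x)).
Proof. by move=> a x y; apply: val_inj; rewrite /= linearP. Qed.
Definition corner_map : {linear corner_part e M -> corner_part e N} :=
  linear_map corner_map_linear.
Lemma corner_mapE x : corner_part_val (corner_map x) = g (corner_part_val x).
Proof. by []. Qed.
End Map.

Lemma corner_map_inj M N (g : {linear M -> N}) :
  injective g -> injective (corner_map g).
Proof.
move=> gI x y gxy; apply/corner_part_val_inj/gI.
by rewrite -!corner_mapE gxy.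
Qed.

Lemma corner_map_surj M N (g : {linear M -> N}) :
  surjective_map g -> surjective_map (corner_map g).
Proof.
move=> gS y; have [x xE] := gS (corner_part_val y).
exists (corner_proj x); apply: corner_part_val_inj.
by rewrite corner_mapE linearZZ xE corner_part_valE.
Qed.

Lemma corner_map_exact A B D (g : {linear A -> B}) (h : {linear B -> D}) :
  exact_at g h -> exact_at (corner_map g) (corner_map h).
Proof.
move=> ex y; split=> [hy|[x <-]]; last first.
  by apply: corner_part_val_inj; apply/ex; exists (corner_part_val x).
have /ex[x xE] : h (corner_part_val y) = 0 by rewrite -corner_mapE hy.
exists (corner_proj x); apply: corner_part_val_inj.
by rewrite corner_mapE linearZZ xE corner_part_valE.
Qed.

Lemma corner_short_exact A B D (g : {linear A -> B}) (h : {linear B -> D}) :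
  short_exact g h -> short_exact (corner_map g) (corner_map h).
Proof.
move=> [gI hS ex]; split; [exact: corner_map_inj | exact: corner_map_surj |].
exact: corner_map_exact.
Qed.

Lemma corner_retract M N :
  retract M N -> retract (corner_part e M) (corner_part e N).
Proof.
move=> [s [p sp]]; exists (corner_map s), (corner_map p) => x.
by apply: corner_part_val_inj; rewrite !corner_mapE sp.
Qed.

Lemma corner_pair_retract M N :
  retract (corner_part e (M * N)%type) (corner_part e M * corner_part e N)%type.
Proof.
exists (pair_map (corner_map (fst_map M N)) (corner_map (snd_map M N))).
exists (copair_map (corner_map (pair_map (idmap M) (zero_map M N)))
  (corner_map (pair_map (zero_map N M) (idmap N)))) => x.
apply: corner_part_val_inj; case: x => -[x y] xy.
by congr pair; rewrite /= ?addr0 ?add0r.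
Qed.

End Functor.

Fact corner_mem (x : L) : eL * x * eL \in peirce_pred e eL.
Proof. by apply/asboolP; exists x. Qed.
Definition to_corner (x : L) : C := Peirce (corner_mem x).

Fact peirce_mem (x : L) : eL * x * (1 - eL) \in peirce_pred e (1 - eL).
Proof. by apply/asboolP; exists x. Qed.

(** The Peirce decomposition x = x e + x (1 - e); through it the hypothesis on e L (1 - e) reaches e
    L. *)
Lemma corner_regular_retract :
  retract (corner_part e L^o) (C^o * peirce e (1 - eL))%type.
Proof.
pose s1 (x : corner_part e L^o) : C^o := to_corner (corner_part_val x).
pose s2 (x : corner_part e L^o) : peirce e (1 - eL) :=
  Peirce (peirce_mem (corner_part_val x)).
have corner_bilinear (c : C) (x y r : L) :
    eL * (val c * x + y) * r = val c * (eL * x * r) + eL * y * r.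
  by rewrite mulrDr mulrDl !mulrA corner_valE peirce_idr.
have l1 : linear s1.
  by move=> a x y; apply: val_inj; apply: corner_bilinear.
have l2 : linear s2.
  by move=> a x y; apply: val_inj; apply: corner_bilinear.
have pP (x : C^o * peirce e (1 - eL)) :
    (val x.1 + val x.2 : L^o) \in corner_part_pred e L^o.
  apply/corner_partP.
  rewrite -[LHS]/(eL * ((val x.1 : L) + (val x.2 : L))) mulrDr.
  by rewrite !peirce_idl.
have lp : linear (fun x => CornerPart (pP x)).
  by move=> a x y; apply: val_inj; rewrite /= scalerDr addrACA.
exists (pair_map (linear_map l1) (linear_map l2)), (linear_map lp) => x.
apply: val_inj; set y : L := corner_part_val x.
rewrite -[LHS]/(eL * y * eL + eL * y * (1 - eL)) -mulrDr addrC subrK mulr1.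
exact: corner_part_valE.
Qed.

Hypothesis fpd_peirce : finite_pdim (peirce e (1 - eL) : lmodType C).

Lemma finite_pdim_corner_free d : finite_pdim (corner_part e (free_module L d)).
Proof.
elim: d => [|d IHd].
  apply/finite_pdim_projective/projective_zero => x.
  by apply: val_inj; apply/ffunP => -[].
have r : retract (free_module L d.+1) (L^o * free_module L d)%type.
  have ls : linear (fun c : free_module L d.+1 =>
    (c ord0, [ffun i => c (lift ord0 i)]) : (L^o * free_module L d)%type).
    by move=> a x y; congr pair; [rewrite !ffunE | apply/ffunP => i; rewrite !ffunE].
  exists (linear_map ls), (copair_map (scale_map (free_gen L ord0))
    (comb (fun i => free_gen L (lift ord0 i)))) => c.
  rewrite [RHS]free_moduleE big_ord_recl; congr (_ + _).
  by apply: eq_bigr => i _; rewrite /= ffunE.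
apply: (finite_pdim_retract (corner_retract r)).
apply: (finite_pdim_retract (corner_pair_retract _ _)).
apply: finite_pdim_pair => //; apply: (finite_pdim_retract corner_regular_retract).
apply: finite_pdim_pair => //.
exact/finite_pdim_projective/projective_regular.
Qed.

(** * Projective dimension of M against that of e M *)

Section Artin.
Variables (k : comPzRingType) (f : {rmorphism k -> L}).
Hypothesis artinL : artin_algebra_over f.

(** Each syzygy is taken from a new finite free cover, because only for these is
    [finite_pdim_corner_free] available; [syzygy_pdim_kernel] keeps the count. *)
Lemma finite_pdim_corner_part (M : lmodType L) :
  finitely_generated M -> finite_pdim M -> finite_pdim (corner_part e M).
Proof.
move=> fgM /finite_pdimP[l lM]; elim: l M fgM lM => [|l IHl] M fgM lM;
    have /finitely_generatedP[d [g gS]] := fgM.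
  have [s sK] := projective_section lM gS.
  apply: finite_pdim_retract (finite_pdim_corner_free d).
  by apply: corner_retract; exists s, g.
have kg := short_exact_kernel gS.
apply: (finite_pdim_quotient (corner_short_exact kg)).
  apply: IHl; first by apply: (artin_fg_submodule artinL); apply: fg_free.
  exact: syzygy_pdim_kernel (@projective_free L d) kg lM.
exact: finite_pdim_corner_free.
Qed.

Fact central_corner (a : k) (x : L) : eL * (f a * x) = f a * (eL * x).
Proof. by have [_ cL _] := artinL; rewrite mulrA -cL mulrA. Qed.

Definition central_to_corner (a : k) : C := to_corner (f a).

Lemma val_central_to_corner a : val (central_to_corner a) = f a * eL.
Proof.
by rewrite /= -[RHS]mulr1 -mulrA mulr1 -{3}(idemP e) -central_corner mulrA.
Qed.

Fact central_to_corner_zmod : zmod_morphism central_to_corner.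
Proof.
move=> a b; apply: val_inj; rewrite !val_central_to_corner rmorphB mulrBl.
by rewrite raddfB /= -!val_central_to_corner.
Qed.
Fact central_to_corner_monoid : monoid_morphism central_to_corner.
Proof.
split=> [|a b]; apply: val_inj; rewrite !val_central_to_corner.
  by rewrite rmorph1 mul1r.
rewrite -[RHS]/(val (central_to_corner a) * val (central_to_corner b)).
by rewrite !val_central_to_corner rmorphM -!mulrA central_corner idemP.
Qed.
Definition central_rmorphism : {rmorphism k -> C} :=
  HB.pack central_to_corner
    (GRing.isZmodMorphism.Build k C central_to_corner central_to_corner_zmod)
    (GRing.isMonoidMorphism.Build k C central_to_corner central_to_corner_monoid).

Lemma val_central a : val (central_rmorphism a) = f a * eL.
Proof. exact: val_central_to_corner. Qed.

Lemma artin_corner : artin_algebra_over central_rmorphism.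
Proof.
have [ak cL fgL] := artinL; split=> //.
  move=> a c; apply: val_inj.
  rewrite -[LHS]/(val (central_rmorphism a) * val c).
  rewrite -[RHS]/(val c * val (central_rmorphism a)) val_central.
  by rewrite -mulrA peirce_idl cL -{1}(peirce_idr c) -mulrA -cL.
have lin : linear (fun x : restrict f L^o =>
    to_corner (x : L) : restrict central_rmorphism C^o).
  move=> a x y; apply: val_inj.
  rewrite -[LHS]/(eL * (f a * (x : L) + (y : L)) * eL).
  rewrite -[RHS]/(val (central_rmorphism a) * (eL * x * eL) + eL * (y : L) * eL).
  by rewrite val_central mulrDr mulrDl central_corner !mulrA -!(mulrA (f a)) idemP.
apply: (fg_surj (f := linear_map lin)) => // c; exists (val (c : C) : L).
apply: val_inj; rewrite -[LHS]/(eL * val (c : C) * eL).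
by rewrite peirce_idl peirce_idr.
Qed.

Lemma fg_corner_part (M : lmodType L) :
  finitely_generated M -> finitely_generated (corner_part e M).
Proof.
move=> /(fg_restrict artinL) fgM; apply: (@fg_of_restrict _ _ central_rmorphism).
have lin : linear (fun x : restrict f M =>
    corner_proj (x : M) : restrict central_rmorphism (corner_part e M)).
  move=> a x y; apply: val_inj.
  rewrite -[LHS]/(eL *: (f a *: (x : M) + (y : M))).
  rewrite -[RHS]/(val (central_rmorphism a) *: (eL *: (x : M)) + eL *: (y : M)).
  rewrite val_central scalerDr !scalerA -mulrA idemP.
  by rewrite -[f a in LHS]mulr1 central_corner mulr1.
apply: (fg_surj (f := linear_map lin)) => // x; exists (corner_part_val x).
exact: corner_proj_val.
Qed.

(* The lift of Q is L e (x)_C Q, realised as a direct summand of L^d. *)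
Lemma projective_lift (Q : lmodType C) (M : lmodType L)
    (q : {linear Q -> corner_part e M}) :
    projective Q -> finitely_generated Q ->
  exists (P : lmodType L) (p : {linear P -> M}) (t : {linear Q -> corner_part e P}),
    [/\ projective P, finitely_generated P, injective t, surjective_map t &
      forall z, corner_map p (t z) = q z].
Proof.
move=> pQ /finitely_generatedP[d [g gS]]; have [s sK] := projective_section pQ gS.
have iotaP (c : free_module C d) :
    [ffun i => val (c i : C) : L^o] \in corner_part_pred e (free_module L d).
  by apply/corner_partP/ffunP => i; rewrite !ffunE; apply: (corner_valE (c i)).
have iota_lin : linear (fun c => CornerPart (iotaP c)).
  by move=> a x y; apply: val_inj; apply/ffunP => i; rewrite !ffunE.
pose iota : {linear free_module C d -> corner_part e (free_module L d)} :=
  linear_map iota_lin.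
have iotaE c i : corner_part_val (iota c) i = val (c i : C) :> L by rewrite /= ffunE.
have iotaI : injective iota.
  move=> x y xy; apply/ffunP => i; apply: val_inj.
  by rewrite -[LHS]iotaE -[RHS]iotaE xy.
pose y i := g (free_gen C i).
have combP (N : lmodType L) (H : {linear Q -> corner_part e N}) c :
    comb (fun i => corner_part_val (H (y i))) (corner_part_val (iota c)) =
    corner_part_val (H (g c)).
  rewrite combE [in RHS](free_moduleE c) !linear_sum /=.
  pose V (x : corner_part e N) := corner_part_val x.
  have VD : {morph V : u v / u + v} by [].
  rewrite -[RHS]/(V _) (big_morph V VD (erefl : V 0 = 0)); apply: eq_bigr => i _.
  by rewrite !linearZZ ffunE.
pose Is := comp_map iota s.
(* The idempotent [s g] of C^d extended to an L-linear endomorphism of L^d; its image is the lift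
   P. *)
pose E := comb (fun i => corner_part_val (Is (y i))).
have EIs z : E (corner_part_val (Is z)) = corner_part_val (Is z).
  by rewrite -[Is z in LHS]/(iota (s z)) combP sK.
have EE r : E (E r) = E r.
  apply: (@linear_free_eq _ _ d (comp_map E E) E) => i.
  by rewrite -[LHS]/(E (E (free_gen L i))) /E comb_free_gen -/E EIs.
have sE := lin_image_submod E.
pose P := submodule sE.
have Emem r : E r \in lin_image E by apply/lin_imageP; exists r.
pose p := comp_map (comb (fun i => corner_part_val (q (y i)))) (submodule_incl sE).
have [|z|t tE] := inj_factor (i := corner_map (submodule_incl sE)) (f := Is).
- exact/corner_map_inj/submodule_incl_inj.
- have [|w wE] := submodule_lift sE (x := corner_part_val (Is z)).
    by rewrite -EIs.
  exists (corner_proj w); apply: corner_part_val_inj.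
  by rewrite corner_mapE linearZZ wE corner_part_valE.
have tvalE z : submodule_incl sE (corner_part_val (t z)) = corner_part_val (Is z).
  by rewrite -tE.
exists P, p, t; split.
- apply: (projective_retract (@projective_free L d)).
  exists (submodule_incl sE), (corestr sE Emem) => x; apply: submodule_incl_inj.
  by rewrite corestrE; have /lin_imageP[r rE] := submodule_inclP x; rewrite -rE EE.
- apply: (fg_surj (f := corestr sE Emem)); last exact: fg_free.
  move=> x; have /lin_imageP[r rE] := submodule_inclP x.
  by exists r; apply: submodule_incl_inj; rewrite corestrE.
- move=> z z' zz'; have := congr1 (corner_map (submodule_incl sE)) zz'.
  by rewrite !tE => /iotaI /(can_inj sK).
- move=> w; pose u := submodule_incl sE (corner_part_val w).
  have eu : eL *: u = u by rewrite -linearZZ corner_part_valE.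
  have Eu : E u = u.
    have /lin_imageP[r rE] := submodule_inclP (corner_part_val w).
    by rewrite /u -rE EE.
  (* Each u i satisfies e (u i) = u i and acts in E u on [Is (y i)], which e fixes; so u i can be
     replaced by e (u i) e, an element of C. *)
  pose c : free_module C d := [ffun i => to_corner (u i : L)].
  exists (g c); apply/corner_part_val_inj/submodule_incl_inj.
  rewrite tvalE -combP -/E -/u -[RHS]Eu /E !combE; apply: eq_bigr => i _.
  have eui : eL * u i = u i by rewrite -[in RHS]eu ffunE.
  by rewrite iotaE ffunE -[val _]/(eL * (u i : L) * eL) eui -scalerA corner_part_valE.
move=> z; apply: corner_part_val_inj.
rewrite corner_mapE -[LHS]/(comb _ (submodule_incl sE (corner_part_val (t z)))).
by rewrite tvalE combP sK.
Qed.

Hypothesis killed : forall M : lmodType L,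
  finitely_generated M -> (forall x : M, eL *: x = 0) -> finite_pdim M.

(** M is an extension of the cokernel of p, which e kills because e p is onto, by the image of p,
    which is P modulo its kernel. *)
Lemma finite_pdim_of_kernel (P M : lmodType L) (p : {linear P -> M}) :
    finitely_generated M -> finite_pdim P -> surjective_map (corner_map p) ->
  finite_pdim (submodule (lin_kernel_submod p)) -> finite_pdim M.
Proof.
move=> fgM fpdP pS fpdK; have sI := lin_image_submod p.
have pI x : p x \in lin_image p by apply/lin_imageP; exists x.
have p'S : surjective_map (corestr sI pI).
  move=> y; have /lin_imageP[x xE] := submodule_inclP y.
  by exists x; apply: submodule_incl_inj; rewrite corestrE.
have kp : short_exact (submodule_incl (lin_kernel_submod p)) (corestr sI pI).
  split=> //; first exact: submodule_incl_inj.
  move=> x; split=> [px|[y <-]].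
    apply: submodule_lift; apply/lin_kernelP.
    by rewrite -(corestrE sI pI) px linear0.
  apply: submodule_incl_inj; rewrite corestrE linear0.
  exact/lin_kernelP/submodule_inclP.
apply: (finite_pdim_extension (quot_short_exact sI)).
  exact: finite_pdim_quotient kp _ _.
have [_ qS exq] := quot_short_exact sI.
apply: killed; first exact: fg_surj qS fgM.
move=> u; have [x <-] := qS u; rewrite -linearZZ.
have [v vE] := pS (corner_proj x).
apply/exq; apply: submodule_lift; apply/lin_imageP; exists (corner_part_val v).
by rewrite -corner_mapE vE.
Qed.

(** In the base case Q is eM itself, and the kernel of p : P -> M is killed by e. In the inductive
    step Q is finite free, and e times the kernel of p is a syzygy of eM. *)
Lemma finite_pdim_of_corner_part l (M : lmodType L) :
  finitely_generated M -> syzygy_pdim l (corner_part e M) -> finite_pdim M.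
Proof.
elim: l M => [|l IHl] M fgM lM.
  have [P [p [t [pP fgP tI tS pt]]]] :=
    projective_lift (idmap _) lM (fg_corner_part fgM).
  apply: (finite_pdim_of_kernel (p := p)) => //.
  - exact: finite_pdim_projective.
  - by move=> z; exists (t z); rewrite pt.
  apply: killed => [|x]; first exact: (artin_fg_submodule artinL).
  have [z zE] := tS (corner_proj (submodule_incl _ x)).
  apply: submodule_incl_inj; rewrite linearZZ linear0.
  rewrite -[LHS]/(corner_part_val (corner_proj (submodule_incl _ x))) -zE.
  rewrite -[z]/(idmap _ z) -pt zE.
  have -> : corner_map p (corner_proj (submodule_incl (lin_kernel_submod p) x)) = 0.
    apply: corner_part_val_inj; rewrite corner_mapE linearZZ.
    by have /lin_kernelP -> := submodule_inclP x; rewrite scaler0.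
  by rewrite linear0.
have /finitely_generatedP[d [q qS]] := fg_corner_part fgM.
have [P [p [t [pP fgP tI tS pt]]]] :=
  projective_lift q (@projective_free C d) (fg_free C d).
have cpS : surjective_map (corner_map p).
  by move=> y; have [z <-] := qS y; exists (t z).
apply: (finite_pdim_of_kernel (p := p)) => //; first exact: finite_pdim_projective.
apply: IHl; first exact: (artin_fg_submodule artinL).
have [_ rPQ] := bij_retract tI tS.
apply: (syzygy_pdim_kernel (i := corner_map (submodule_incl (lin_kernel_submod p)))
  (a := corner_map p) _ _ lM).
  exact: projective_retract (@projective_free C d) rPQ.
split=> //; first exact/corner_map_inj/submodule_incl_inj.
apply: corner_map_exact => x; split=> [px|[y <-]].
  by apply: submodule_lift; apply/lin_kernelP.
exact/lin_kernelP/submodule_inclP.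
Qed.

Lemma in_Pfin_corner_part (M : lmodType L) :
  finitely_generated M -> in_Pfin M <-> in_Pfin (corner_part e M).
Proof.
move=> fgM; split=> [[_ fpdM]|[_ /finite_pdimP[l lM]]]; split=> //.
- exact: fg_corner_part.
- exact: finite_pdim_corner_part.
exact: finite_pdim_of_corner_part lM.
Qed.
End Artin.
End CornerPart.

(** * Coinduction *)

Section Coinduction.
Variables (L : pzRingType) (e : idempotent_elt L).
Local Notation C := (corner e).
Local Notation eL := (idem_val e).

Section CoinducedModule.
Variable X : lmodType C.

(* [Hom_C(e L, X)]; a map on [e L] is encoded as a map [phi] on [L] with
   [phi (e r) = phi r]. *)
Definition coinduced_axiom (phi : L -> X) : Prop :=
  [/\ {morph phi : r s / r + s},
      forall (c : C) r, phi (val c * r) = c *: phi r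
    & forall r, phi (eL * r) = phi r].

Record coinduced := Coinduced {
  coinduced_fun :> L -> X; coinducedP : coinduced_axiom coinduced_fun }.

Lemma coinduced_eq (phi psi : coinduced) : phi =1 psi -> phi = psi.
Proof.
case: phi psi => phi phiP [psi psiP] /= /funext E.
by rewrite E in phiP *; congr Coinduced; apply: Prop_irrelevance.
Qed.

HB.instance Definition _ := gen_eqMixin coinduced.
HB.instance Definition _ := gen_choiceMixin coinduced.

Fact coinduced_zeroP : coinduced_axiom (fun=> 0).
Proof. by split=> [r s|c r|r] //; rewrite ?addr0 ?scaler0. Qed.
Fact coinduced_addP (phi psi : coinduced) :
  coinduced_axiom (fun r => phi r + psi r).
Proof.
have [D1 S1 E1] := coinducedP phi; have [D2 S2 E2] := coinducedP psi.
split=> [r s|c r|r]; first by rewrite D1 D2 addrACA.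
  by rewrite S1 S2 scalerDr.
by rewrite E1 E2.
Qed.
Fact coinduced_oppP (phi : coinduced) : coinduced_axiom (fun r => - phi r).
Proof.
have [D1 S1 E1] := coinducedP phi.
by split=> [r s|c r|r]; rewrite ?D1 ?opprD ?S1 ?scalerN ?E1.
Qed.
Fact coinduced_scaleP (a : L) (phi : coinduced) :
  coinduced_axiom (fun r => phi (r * a)).
Proof.
have [D1 S1 E1] := coinducedP phi.
split=> [r s|c r|r]; first by rewrite mulrDl D1.
  by rewrite -mulrA S1.
by rewrite -mulrA E1.
Qed.

Definition coinduced_zero := Coinduced coinduced_zeroP.
Definition coinduced_add phi psi := Coinduced (coinduced_addP phi psi).
Definition coinduced_opp phi := Coinduced (coinduced_oppP phi).
Definition coinduced_scale a phi := Coinduced (coinduced_scaleP a phi).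

Fact coinduced_addA : associative coinduced_add.
Proof. by move=> u v w; apply: coinduced_eq => r; apply: addrA. Qed.
Fact coinduced_addC : commutative coinduced_add.
Proof. by move=> u v; apply: coinduced_eq => r; apply: addrC. Qed.
Fact coinduced_add0 : left_id coinduced_zero coinduced_add.
Proof. by move=> u; apply: coinduced_eq => r; apply: add0r. Qed.
Fact coinduced_addN : left_inverse coinduced_zero coinduced_opp coinduced_add.
Proof. by move=> u; apply: coinduced_eq => r; apply: addNr. Qed.
HB.instance Definition _ := GRing.isZmodule.Build coinduced
  coinduced_addA coinduced_addC coinduced_add0 coinduced_addN.

Fact coinduced_scalerA a b u :
  coinduced_scale a (coinduced_scale b u) = coinduced_scale (a * b) u.
Proof. by apply: coinduced_eq => r /=; rewrite mulrA. Qed.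
Fact coinduced_scale1r : left_id 1 coinduced_scale.
Proof. by move=> u; apply: coinduced_eq => r /=; rewrite mulr1. Qed.
Fact coinduced_scalerDr : right_distributive coinduced_scale +%R.
Proof. by move=> a u v; apply: coinduced_eq. Qed.
Fact coinduced_scalerDl u : {morph coinduced_scale^~ u : a b / a + b}.
Proof.
move=> a b; apply: coinduced_eq => r /=; have [D1 _ _] := coinducedP u.
by rewrite mulrDr D1.
Qed.
HB.instance Definition _ := GRing.Zmodule_isLmodule.Build L coinduced
  coinduced_scalerA coinduced_scale1r coinduced_scalerDr coinduced_scalerDl.

End CoinducedModule.

Section FiniteGeneration.
Variables (k : comPzRingType) (f : {rmorphism k -> L}).
Hypothesis artinL : artin_algebra_over f.

(** Evaluation at generators of L over [k] embeds Hom_C(eL, X) [k]-linearly into a finite power of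
    X. *)
Lemma fg_coinduced (X : lmodType C) :
  finitely_generated X -> finitely_generated (coinduced X).
Proof.
move=> /(fg_restrict (artin_corner e artinL)) fgX.
have [ak cL [d [g gE]]] := artinL.
pose kc := central_rmorphism e artinL.
have phi_f (phi : coinduced X) (a : k) r : phi (f a * r) = kc a *: phi r.
  have [_ S1 E1] := coinducedP phi.
  by rewrite -S1 val_central -[LHS]E1 (central_corner _ artinL) mulrA.
have hlin (i : 'I_d) : linear (fun phi : restrict f (coinduced X) =>
    (phi : coinduced X) (g i) : restrict kc X).
  move=> a phi psi.
  rewrite -[LHS]/((phi : coinduced X) (g i * f a) + (psi : coinduced X) (g i)).
  by rewrite -cL phi_f.
have [P [F [fgP FP]]] := joint_embedding (fun i => linear_map (hlin i)) fgX.
apply: (@fg_of_restrict _ _ f); apply: (fg_inj (f := F)) => //.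
apply: raddf_inj => phi /FP phi0; apply: coinduced_eq => r.
have [D1 S1 E1] := coinducedP (phi : coinduced X).
have [c ->] := gE r.
have phi_0 : (phi : coinduced X) 0 = 0.
  by apply: (@addIr _ ((phi : coinduced X) 0)); rewrite -D1 !add0r.
rewrite -[RHS]/(0 : X) (big_morph _ D1 phi_0) big1 // => i _.
rewrite -[c i *: _]/(f (c i) * g i) phi_f -[_ (g i)]/(linear_map (hlin i) phi).
by rewrite phi0 scaler0.
Qed.
End FiniteGeneration.

(** * Pullbacks along the unit of the adjunction *)

Section Pullback.
Variables (M : lmodType L) (X : lmodType C) (a : {linear X -> corner_part e M}).

(* The pullback of [Hom_C(e L, a)] along the unit [M -> Hom_C(e L, e M)]. *)
Definition pullback_pred : {pred (M * coinduced X)%type} := fun u =>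
  `[< forall r, corner_part_val (a (u.2 r)) = (eL * r) *: u.1 >].

Lemma pullbackP (u : M * coinduced X) : reflect
  (forall r, corner_part_val (a (u.2 r)) = (eL * r) *: u.1) (u \in pullback_pred).
Proof. exact: asboolP. Qed.

Fact pullback_submod : submod_closed pullback_pred.
Proof.
split=> [|b u v /pullbackP uP /pullbackP vP]; apply/pullbackP => r.
  by rewrite scaler0 linear0.
rewrite -[(b *: u + v).2 r]/(u.2 (r * b) + v.2 r).
rewrite -[(b *: u + v).1]/(b *: u.1 + v.1) linearD corner_part_valD uP vP.
by rewrite scalerDr scalerA mulrA.
Qed.

Definition pullback : lmodType L := submodule pullback_submod.

Definition pullback_fst : {linear pullback -> M} :=
  comp_map (fst_map M (coinduced X)) (submodule_incl pullback_submod).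

(** A map on L with phi (e r) = phi r takes the same value at 1 and at e, so this is the counit e
    Hom_C(eL, X) -> X on second components. *)
Lemma pullback_eval_linear :
  linear (fun u : corner_part e pullback =>
    (submodule_incl pullback_submod (corner_part_val u)).2 1).
Proof.
move=> c u v; set i := submodule_incl _.
rewrite -[LHS]/((i (corner_part_val u)).2 (1 * val c) + (i (corner_part_val v)).2 1).
have [_ S1 _] := coinducedP (i (corner_part_val u)).2.
by rewrite mul1r -[val c]mulr1 S1.
Qed.
Definition pullback_eval : {linear corner_part e pullback -> X} :=
  linear_map pullback_eval_linear.

Lemma pullback_evalE u : corner_part_val (a (pullback_eval u)) =
  pullback_fst (corner_part_val u).
Proof.
have /pullbackP/(_ 1) := submodule_inclP (corner_part_val u).
rewrite mulr1 => uE; rewrite -[LHS]/(corner_part_val (a (_ 1))) uE.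
by rewrite -[RHS]/(pullback_fst _) -[in RHS]corner_part_valE linearZZ.
Qed.

(** Adjunction combined with the universal property of the pullback: y goes to the pair of g y and r
    |-> h (e r y), the latter being the adjoint of h. *)
Lemma pullback_lift (Y : lmodType L) (g : {linear Y -> M})
    (h : {linear corner_part e Y -> X}) :
    (forall y, a (h y) = corner_map e g y) ->
  exists H : {linear Y -> pullback}, (forall y, pullback_fst (H y) = g y) /\
    forall y, pullback_eval (corner_map e H y) = h y.
Proof.
move=> ah.
have phiP (y : Y) : coinduced_axiom (fun r => h (corner_proj e (r *: y))).
  split=> [r s|c r|r]; rewrite -?linearD -?linearZZ; congr (h _);
    apply: corner_part_val_inj.
  - by rewrite /= scalerDl scalerDr.
  - by rewrite /= !scalerA !mulrA corner_valE peirce_idr.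
  - by rewrite /= !scalerA mulrA idemP.
have lin : linear (fun y => (g y, Coinduced (phiP y)) : (M * coinduced X)%type).
  move=> b x y; congr pair; first exact: linearP.
  apply: coinduced_eq => r; rewrite -[LHS]/(h (corner_proj e (r *: (b *: x + y)))).
  rewrite -[RHS]/(h (corner_proj e ((r * b) *: x)) + h (corner_proj e (r *: y))).
  rewrite -linearD; congr (h _); apply: corner_part_val_inj => /=.
  by rewrite [r *: (_ + _)]scalerDr (scalerA r) scalerDr.
have mem y : linear_map lin y \in pullback_pred.
  apply/pullbackP => r; rewrite -[LHS]/(corner_part_val (a (h _))) ah corner_mapE.
  rewrite -[LHS]/(g (eL *: (r *: y))) -[RHS]/((eL * r) *: g y).
  by rewrite scalerA linearZZ.
exists (corestr pullback_submod mem); split=> // y.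
rewrite -[LHS]/(h (corner_proj e (1 *: corner_part_val y))) scale1r.
by rewrite corner_proj_val.
Qed.

(** The unit M -> Hom_C(eL, eM) becomes an isomorphism on e-parts, so the pullback has the e-part of
    Hom_C(eL, X), which is X. The preimage of z is the pair of a z and r |-> (e r e) z. *)
Lemma pullback_eval_bij : injective pullback_eval /\ surjective_map pullback_eval.
Proof.
split=> [|z].
  apply: raddf_inj => u u0; apply/corner_part_val_inj/submodule_incl_inj.
  have fst0 : pullback_fst (corner_part_val u) = 0.
    by rewrite -pullback_evalE u0 linear0.
  rewrite !linear0; set v := submodule_incl _ _.
  have ev : eL *: v = v by rewrite -linearZZ corner_part_valE.
  have [_ S1 E1] := coinducedP v.2.
  rewrite [v]surjective_pairing; congr pair => //.
  (* From v = e v follows v.2 r = (e r e) v.2 1, so the second component vanishes with its value at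
     1. *)
  apply: coinduced_eq => r; rewrite -[in LHS]ev -[LHS]/(v.2 (r * eL)) -E1 mulrA.
  rewrite -[eL * r * eL]/(val (to_corner e r)) -[val _]mulr1 S1.
  by rewrite -[v.2 1]/(pullback_eval u) u0 scaler0.
have phiP : coinduced_axiom (fun r => to_corner e r *: z).
  split=> [r s|c r|r].
  - by rewrite -scalerDl; congr (_ *: _); apply: val_inj; rewrite /= mulrDr mulrDl.
  - rewrite scalerA; congr (_ *: _); apply: val_inj.
    by rewrite /= !mulrA corner_valE peirce_idr.
  - by congr (_ *: _); apply: val_inj; rewrite /= !mulrA idemP.
have mem : (corner_part_val (a z), Coinduced phiP) \in pullback_pred.
  apply/pullbackP => r.
  rewrite -[LHS]/(corner_part_val (a (to_corner e r *: z))) linearZZ.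
  by rewrite corner_part_scaleE /= -scalerA corner_part_valE.
have [u uE] := submodule_lift pullback_submod mem.
exists (corner_proj e u).
rewrite -[LHS]/((submodule_incl pullback_submod (eL *: u)).2 1) linearZZ uE.
rewrite -[LHS]/(to_corner e (1 * eL) *: z) -[RHS]scale1r; congr (_ *: _).
by apply: val_inj; rewrite /= mul1r !idemP.
Qed.

End Pullback.
End Coinduction.

(** * Transfer of approximations between L and its corner *)

Theorem theoremB (L : pzRingType) (hartin : artin_algebra L) (hbasic : basic L)
    (n : nat) (eps : 'I_n -> L) (heps : complete_orth_primitive eps)
    (m : nat) (hm : (m <= n)%N)
    (e : idempotent_elt L) (he : idem_val e = \sum_(i < n | (i < m)%N) eps i)
    (hsimple : forall i : 'I_n, ~ finite_pdim (simple_top (eps i)) -> (i < m)%N)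
    (hpd : finite_pdim (peirce e (1 - idem_val e) : lmodType (corner e))) :
  Pfin_contravariantly_finite L <-> Pfin_contravariantly_finite (corner e).
Proof.
have [k [f [ak cL fgL]]] := hartin.
have artinL : artin_algebra_over f by [].
have killed := finite_pdim_killed artinL heps he hsimple.
have Pfin M fgM := @in_Pfin_corner_part L e hpd k f artinL killed M fgM.
have fg_pullback (M : lmodType L) (X : lmodType (corner e))
    (a : {linear X -> corner_part e M}) : finitely_generated M ->
    finitely_generated X -> finitely_generated (pullback a).
  move=> fgM fgX; apply: (artin_fg_submodule artinL); apply: fg_pair => //.
  exact: fg_coinduced artinL _ fgX.
have Pfin_pullback (M : lmodType L) (X : lmodType (corner e))
    (a : {linear X -> corner_part e M}) : finitely_generated M ->
    in_Pfin X -> in_Pfin (pullback a).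
  move=> fgM [fgX fpdX]; have fgW := fg_pullback M X a fgM fgX.
  apply/Pfin => //; split; first exact: (fg_corner_part e artinL fgW).
  have [evI evS] := pullback_eval_bij a.
  by apply: finite_pdim_retract fpdX; have [] := bij_retract evI evS.
split=> [cfL M' fgM'|cfC M fgM].
  (* Pullbacks over the zero module are the modules Hom_C(eL, -), so the module approximated below
     is Hom_C(eL, M'). *)
  pose Z := zero_module L.
  have fgZ : finitely_generated Z.
    exact/fg_zero/zero_moduleP.
  pose z (X : lmodType (corner e)) := zero_map X (corner_part e Z).
  have [X [phi [PX phiP]]] := cfL (pullback (z M')) (fg_pullback _ _ _ fgZ fgM').
  have [fgX _] := PX.
  exists (corner_part e X), (comp_map (pullback_eval (z M')) (corner_map e phi)).
  split=> [|Y g PY]; first exact/Pfin.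
  (* The test object Y is identified with e Hom_C(eL, Y), [s] being the inverse of the counit; g
     then induces a map H from Hom_C(eL, Y) to Hom_C(eL, M'), which factors through phi. *)
  have [evI evS] := pullback_eval_bij (z Y).
  have [|s sE] := inj_factor (f := idmap Y) evI; first exact: evS.
  have [|H [_ HE]] := pullback_lift (a := z M') (g := pullback_fst (z Y))
    (h := comp_map g (pullback_eval (z Y))).
    move=> y; apply: corner_part_val_inj.
    by rewrite [LHS]zero_moduleP [RHS]zero_moduleP.
  have [u uE] := phiP _ H (Pfin_pullback _ _ (z Y) fgZ PY).
  exists (comp_map (corner_map e u) s) => y.
  have -> : g y = pullback_eval (z M') (corner_map e H (s y)).
    by rewrite HE -[LHS]/(g (idmap Y y)) -sE.
  by congr (pullback_eval _ _); apply: corner_part_val_inj; apply: uE.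
have [X [a [PX aP]]] := cfC _ (fg_corner_part e artinL fgM).
exists (pullback a), (pullback_fst a); split; first exact: Pfin_pullback.
move=> Y g PY; have [fgY _] := PY.
(* The approximation of eM factors e g as a h, and the pullback turns h into a factorization of
   g. *)
have [|h hE] := aP _ (corner_map e g); first exact/Pfin.
have [|H [HE _]] := pullback_lift (a := a) (g := g) (h := h); first by move=> y.
by exists H => y; rewrite HE.
Qed.
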